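(* For every integer $n \geq 1$, the following decision problem is algorithmically undecidable: given a finite system of non-commutative polynomial equations $$P_1(X_1,\dots,X_k)=0,\quad P_2(X_1,\dots,X_k)=0,\quad \dots,\quad P_r(X_1,\dots,X_k)=0,$$ with $P_1,\dots,P_r\in\mathbb Z[X_1,\dots,X_k]$ non-commutative polynomials ($k$ and $r$ being part of the input), decide whether it has a solution $(X_1,\dots,X_k)\in M_n(\mathbb N)^k$.
   Context: $\mathbb N$ denotes the natural numbers including $0$, and $M_n(\mathbb N)$ is the set of $n\times n$ matrices with entries in $\mathbb N$. $\mathbb Z[X_1,\dots,X_k]$ denotes here the ring of non-commutative polynomials with integer coefficients in the variables $X_1,\dots,X_k$ (the free associative unital ring; the variables do not commute with each other). Such a polynomial is evaluated at a tuple of $n\times n$ matrices using matrix addition and multiplication, where an integer $c$ occurring as a coefficient or as a free term is interpreted as $cI_n$, with $I_n$ the identity matrix; $0$ is interpreted as the zero matrix. Undecidable means that there is no algorithm (Turing machine) which on every input halts with the correct yes/no answer. *)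

(* Defs.v *)
From HB Require Import structures.
From mathcomp Require Import all_boot all_order all_algebra.
From mathcomp Require Import finmap.
From mathcomp.multinomials Require Import monalg.

Set Implicit Arguments.
Unset Strict Implicit.
Unset Printing Implicit Defensive.

Import Order.TTheory GRing.Theory Num.Theory.
Local Open Scope ring_scope.

(* Deterministic one-tape Turing machines over a finite input alphabet A.
   A tape symbol is the blank [None], an input symbol [Some (inl a)] or an
   auxiliary symbol [Some (inr x)].  [verdict q = Some b] says that q is a
   halting state, accepting if b = true and rejecting if b = false. *)

Inductive direction := ToLeft | ToRight.

Record machine (A : finType) := Machine {
  state : finType;
  work : finType;
  start : state;
  verdict : state -> option bool;
  trans : state -> option (A + work) -> state * option (A + work) * direction
}.

Section Machine.
Variables (A : finType) (M : machine A).

Definition symbol := option (A + work M).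

(* In (q, (l, r)), the list l is the tape to the left of the head, nearest cell
   first, and r is the tape from the scanned cell on; all further cells are
   blank, so the tape is infinite in both directions. *)
Definition config := (state M * (seq symbol * seq symbol))%type.

Definition initial (w : seq A) : config :=
  (start M, ([::], [seq Some (inl a) | a <- w])).

Definition step (c : config) : config :=
  let: (q, (l, r)) := c in
  if verdict q is Some _ then c else
  let: (q', a, d) := trans q (head None r) in
  match d with
  | ToRight => (q', (a :: l, behead r))
  | ToLeft => (q', (behead l, head None l :: a :: behead r))
  end.

Definition answers (w : seq A) (b : bool) : Prop :=
  exists t : nat, verdict (iter t step (initial w)).1 = Some b.

Definition decides (I : Type) (code : I -> seq A) (P : I -> Prop) : Prop :=
  forall x : I, exists b : bool, answers (code x) b /\ (b = true <-> P x).

End Machine.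

Definition undecidable (A : finType) (I : Type) (code : I -> seq A)
    (P : I -> Prop) : Prop :=
  ~ exists M : machine A, decides M code P.

(* Z<X_1, ..., X_k>: the monoid ring over Z of the free monoid on 'I_k. *)
Definition ncpoly (k : nat) := {malg int[{fmonom 'I_k}]}.

Definition nceval (n k : nat) (X : 'I_k -> 'M[int]_n) (P : ncpoly k) :
    'M[int]_n :=
  \sum_(m <- msupp P) (P@_m)%:M *m \prod_(i <- (m : seq 'I_k)) X i.

Record ncsystem := NCSystem {
  nvars : nat;
  equations : seq (ncpoly nvars)
}.

Definition solvable_in_nat_matrices (n : nat) (S : ncsystem) : Prop :=
  exists X : 'I_(nvars S) -> 'M[nat]_n,
    forall P : ncpoly (nvars S), P \in equations S ->
      nceval (fun i => map_mx Posz (X i)) P = 0.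

(* A system is written as the number of variables followed by its equations,
   a polynomial as the list of its terms (nonzero coefficient, then word) in the
   lexicographic order of the words.  All numbers are in unary; for instance
   2 - X_1 X_0 in two variables is [11 E T11 T-1 V1 V] with the letters
   1 = One, - = Minus, V = Var, T = Term, E = Equation. *)

Inductive letter := One | Minus | Var | Term | Equation.

Definition ord_of_letter (a : letter) : 'I_5 :=
  inord match a with
        | One => 0 | Minus => 1 | Var => 2 | Term => 3 | Equation => 4
        end.

Definition letter_of_ord (i : 'I_5) : letter :=
  nth One [:: One; Minus; Var; Term; Equation] i.

Lemma ord_of_letterK : cancel ord_of_letter letter_of_ord.
Proof. by case; rewrite /letter_of_ord inordK. Qed.

HB.instance Definition _ := Finite.copy letter (can_type ord_of_letterK).

Definition code_int (c : int) : seq letter :=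
  match c with
  | Posz p => nseq p One
  | Negz p => Minus :: nseq p.+1 One
  end.

Definition code_word (k : nat) (m : {fmonom 'I_k}) : seq letter :=
  flatten [seq Var :: nseq i One | i : 'I_k <- m].

Definition word_le (k : nat) : rel {fmonom 'I_k} :=
  fun u v => ((u : seqlexi 'I_k) <= (v : seqlexi 'I_k))%O.

Definition code_poly (k : nat) (P : ncpoly k) : seq letter :=
  Equation :: flatten [seq Term :: code_int P@_m ++ code_word m
                      | m <- sort (@word_le k) (msupp P)].

Definition code_system (S : ncsystem) : seq letter :=
  nseq (nvars S) One ++ flatten [seq code_poly P | P <- equations S].

(* Main.v *)
Require Import Defs.
From mathcomp Require Import all_boot all_order all_algebra.
From HB Require Import structures.
From Stdlib Require Import FunctionalExtensionality.
From mathcomp Require Import zify ring.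
From mathcomp Require Import finmap.
From mathcomp.multinomials Require Import monalg.

(** Why the problem is undecidable.

    Suppose that a machine M decides solvability.  The contradiction comes from
    a system of equations that is solvable exactly when M rejects its code, so
    that M is the only machine in the argument and no Turing machine has to be
    constructed.

    Self-reference.  Consider the systems made of one equation X_0 - a = 0 and
    of further equations that do not depend on a.  The constant a is written in
    unary, so the code of such a system is u 1^a w with fixed words u and w
    ([code_system_at]).  If a is itself a number from which u and w can be
    recovered, then the property that M rejects u 1^a w is a property of a alone
    ([rejects_code]).  Once it is known to be Diophantine, it is expressed by
    equations with the parameter a; these give u and w, hence a number a, and the
    resulting system is solvable if and only if M rejects its code.

    Rejection is Diophantine.  A configuration of M is a pair of numbers, one for
    each half of the tape with the state in the lowest digit of the first, and a
    step of M is an affine rewriting x = a u + b, y = c v + d to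
    x' = a' u + b', y' = c' v + d' ([machine_rule], [vanishes_config]).  A whole
    run is packed in a few numbers, whose digits in a large base Q = 2^N are the
    successive values; that the digits are of the right form is expressed by
    inclusion of binary digits, and that each step follows from the preceding one
    by a single equation between numbers shifted by one digit ([history],
    [dioph_vanishes]).  Inclusion of the binary digits of x among those of y means
    that the binomial coefficient of y over x is odd (Lucas, [sub_bitsE]), and
    binomial coefficients are the digits of (W + 1)^n in a large base W
    ([bin_digit]).  It remains to see that exponentiation is Diophantine: this is
    the theorem of Matiyasevich ([dioph_expn]), which rests on the divisibility
    properties of the solutions of x^2 - (a^2 - 1) y^2 = 1
    ([dioph_pell]).

    Matrices.  To pass from numbers to matrices of size n, matrices V_ij are added
    as unknowns, with the equations sum_j V_jj = 1 and, for every j,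
    sum_i V_ij V_jj V_ji = 1.  Over the natural numbers the first equation makes
    every V_jj diagonal with disjoint supports, and the others make every V_jj
    nonzero; by counting, each of them has a single nonzero entry
    ([unit_decomposition]).  A matrix that commutes with V_00 has, in the row of
    that entry, no other nonzero entry than the diagonal one.  If all the original
    unknowns commute with V_00, then evaluation at that diagonal position commutes
    with sums and products, and yields a solution in natural numbers.  Conversely,
    a solution in natural numbers gives scalar matrices. *)

Set Implicit Arguments.
Unset Strict Implicit.
Unset Printing Implicit Defensive.

Import Order.TTheory GRing.Theory Num.Theory.

(** * The Pell sequences as a Diophantine relation *)

Section Pell.
Local Open Scope ring_scope.

Lemma dvdzD_eq (d s t u : int) : s = t + u -> (d %| t)%Z -> (d %| u)%Z -> (d %| s)%Z.
Proof. by move=> ->; apply: rpredD. Qed.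

Lemma dvdzB_eq (d s t u : int) : s = t - u -> (d %| t)%Z -> (d %| u)%Z -> (d %| s)%Z.
Proof. by move=> ->; apply: rpredB. Qed.

Lemma dvdz_small (d z : int) : (d %| z)%Z -> - d < z < d -> z = 0.
Proof.
case/dvdzP => q -> /andP[gt lt]; have [->|[q1|q1]] : q = 0 \/ 1 <= q \/ q <= -1 by lia.
- by rewrite mul0r.
- by nia.
by nia.
Qed.

(** The powers of the fundamental unit: x + y sqrt(a^2 - 1) = (a + sqrt(a^2 - 1))^n.
    Integer values leave room for negative terms in congruences. *)
Fixpoint pell (a : int) (n : nat) : int * int :=
  if n is n'.+1 then
    let: (x, y) := pell a n' in (a * x + (a ^+ 2 - 1) * y, x + a * y)
  else (1, 0).

Local Notation px a n := (pell a n).1.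
Local Notation py a n := (pell a n).2.

Lemma pxS a n : px a n.+1 = a * px a n + (a ^+ 2 - 1) * py a n.
Proof. by rewrite /=; case: (pell a n). Qed.

Lemma pyS a n : py a n.+1 = px a n + a * py a n.
Proof. by rewrite /=; case: (pell a n). Qed.

Lemma pell_norm a n : px a n ^+ 2 - (a ^+ 2 - 1) * py a n ^+ 2 = 1.
Proof.
elim: n => [|n IHn] /=; first by ring.
by rewrite -[RHS]IHn; case: (pell a n) => x y /=; ring.
Qed.

Lemma pell_add a m n :
  (px a (m + n) = px a m * px a n + (a ^+ 2 - 1) * py a m * py a n) *
  (py a (m + n) = px a m * py a n + py a m * px a n).
Proof.
elim: m => [|m [IHx IHy]]; first by rewrite /=; split; ring.
by rewrite addSn !pxS !pyS IHx IHy; split; ring.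
Qed.

(** Modulo x_(n+m), this says that x changes sign under the reflection of the
    index at n + m. *)
Lemma px_chord a m n : px a (n + 2 * m) + px a n = 2 * px a (n + m) * px a m.
Proof.
rewrite (_ : (n + 2 * m)%N = (n + m + m)%N); last by lia.
have N := pell_norm a m; set E := LHS; set F := RHS.
suff : E - F = px a n * (1 - (px a m ^+ 2 - (a ^+ 2 - 1) * py a m ^+ 2)).
  by rewrite N subrr mulr0 => /eqP; rewrite subr_eq0 => /eqP.
rewrite /E /F (pell_add a (n + m) m).1 (pell_add a n m).1 (pell_add a n m).2; ring.
Qed.

Section Base.
Variables (a : int) (a_gt1 : 1 < a).

Lemma pell_ge n : n%:Z <= py a n /\ 1 <= px a n.
Proof.
elim: n => [|n [IHy IHx]] //; rewrite pxS pyS; split; first nia.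
have : 0 <= (a ^+ 2 - 1) * py a n by rewrite mulr_ge0 //; nia.
nia.
Qed.

Lemma py_lt m n : (m < n)%N -> py a m < py a n.
Proof.
elim: n => // n IHn; rewrite ltnS leq_eqVlt => /predU1P[->|/IHn];
by rewrite pyS; have := pell_ge n; nia.
Qed.

(** Since x at least doubles at each step, two values below x_n have a sum and a
    difference smaller than x_n; the only exception is 2 x_0 = x_1 for a = 2. *)
Lemma px_lt m n : (m < n)%N ->
  2 * px a m < px a n \/ m = 0%N /\ 2 * px a m <= px a n.
Proof.
elim: n => // n IHn; rewrite ltnS leq_eqVlt pxS.
have [y_n x_n] := pell_ge n; have d_ge3 : 3 <= a ^+ 2 - 1 by nia.
case/predU1P => [->|/IHn]; last by nia.
have : n = 0%N \/ 1 <= py a n by lia.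
by case=> [->|?]; [right|left]; rewrite /=; nia.
Qed.

Lemma px_inj m n : px a m = px a n -> m = n.
Proof.
by have [/px_lt|/px_lt|//] := ltngtP m n; have := pell_ge m; have := pell_ge n; lia.
Qed.

(** Descent: dividing x + y sqrt(a^2 - 1) by the fundamental unit gives a solution
    with a smaller y. *)
Lemma pell_complete (x y : int) : 0 <= x -> 0 <= y -> x ^+ 2 - (a ^+ 2 - 1) * y ^+ 2 = 1 ->
  exists n, (x, y) = pell a n.
Proof.
move=> + y0; have [m] := ubnP `|y|%N; elim: m => // m IHm in x y y0 *.
move=> ym x0 E; have [y_0|y_gt0] : y = 0 \/ 0 < y by lia.
  by exists 0%N; rewrite y_0 /=; congr (_, _); nia.
have x1 : x <= a * y by apply: contraTT isT => ?; nia.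
have x2 : (a - 1) * y < x by apply: contraTT isT => ?; nia.
have x3 : 0 <= a * x - (a ^+ 2 - 1) * y by nia.
(* The quotient of (x, y) by the fundamental unit. *)
have E' : (a * x - (a ^+ 2 - 1) * y) ^+ 2 - (a ^+ 2 - 1) * (a * y - x) ^+ 2 = 1.
  by apply: etrans E; ring.
have [||n En] := IHm _ (a * y - x) _ _ x3 E'; try lia.
by exists n.+1; rewrite /= -En; congr (_, _); ring.
Qed.

Lemma px_dvd_eq i n : (i <= n)%N -> (px a n %| px a i)%Z -> i = n.
Proof.
rewrite leq_eqVlt => /predU1P[//|i_n] dv; have := px_lt i_n; have := pell_ge i; have := pell_ge n.
case/dvdzP: dv => q ->; have [?|?] : q <= 0 \/ 1 <= q by lia.
  by nia.
by nia.
Qed.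

Lemma coprime_pell n : coprimez (px a n) (py a n).
Proof.
apply/coprimezP; exists (px a n, - (a ^+ 2 - 1) * py a n) => /=.
by apply: etrans (pell_norm a n); ring.
Qed.

Lemma dvd_py_mul i q : (py a i %| py a (i * q))%Z.
Proof.
elim: q => [|q IHq]; first by rewrite muln0 dvdz0.
rewrite mulnS (pell_add a i _).2; apply: rpredD; first exact: dvdz_mull.
exact: dvdz_mulr.
Qed.

(** Expansion of (x_i + y_i sqrt(a^2 - 1))^q modulo y_i^2.  The congruence for
    y_(iq) is multiplied by x_i to avoid the exponent q - 1. *)
Lemma pell_mul_mod i q :
  (py a i ^+ 2 %| px a (i * q) - px a i ^+ q)%Z /\
  (py a i ^+ 2 %| px a i * py a (i * q) - q%:Z * px a i ^+ q * py a i)%Z.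
Proof.
elim: q => [|q [/dvdzP[s Es] /dvdzP[t Et]]].
  by rewrite muln0 /= expr0 !mul0r mulr0 subrr dvdz0.
have /dvdzP[r Er] := dvd_py_mul i q.
have {}Es : px a (i * q) = px a i ^+ q + s * py a i ^+ 2 by rewrite -Es; ring.
have {}Et : px a i * py a (i * q) = q%:Z * px a i ^+ q * py a i + t * py a i ^+ 2.
  by rewrite -Et; ring.
rewrite mulnS addnC (pell_add a _ i).1 (pell_add a _ i).2 [px a i ^+ q.+1]exprS; split.
  apply/dvdzP; exists (s * px a i + (a ^+ 2 - 1) * r).
  by rewrite Es Er; ring.
apply/dvdzP; exists (s * px a i * py a i + t * px a i).
set c := (q.+1)%:Z; have -> : c = q%:Z + 1 by lia.
transitivity (px a i * py a i * px a (i * q) + px a i * (px a i * py a (i * q))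
  - (q%:Z + 1) * (px a i * px a i ^+ q) * py a i); first by ring.
by rewrite Et Es; ring.
Qed.

(** With n = i q + r, the addition formula reduces divisibility of y_n by y_i to
    divisibility of y_r by y_i, and y_r is smaller than y_i. *)
Lemma py_dvd i n : (py a i %| py a n)%Z -> (i %| n)%N.
Proof.
rewrite {1}(divn_eq n i) mulnC (pell_add a _ _).2 => dv.
have : (py a i %| py a (n %% i))%Z.
  move: dv; rewrite rpredDr; last by rewrite dvdz_mulr // dvd_py_mul.
  rewrite Gauss_dvdzr //.
  have := coprime_pell (i * (n %/ i)); rewrite coprimez_sym.
  exact/coprimez_dvdl/dvd_py_mul.
have [->|i_gt0] := posnP i.
  by rewrite modn0 /= dvd0z => /eqP; case: n {dv} => // n; have := pell_ge n.+1; lia.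
have lt_i : (n %% i < i)%N by rewrite ltn_mod.
have [y_ge _] := pell_ge (n %% i); have := py_lt lt_i.
move=> lt_y /dvdzP[q Eq]; rewrite /dvdn.
have [?|?] : q <= 0 \/ 1 <= q by lia.
  by nia.
by nia.
Qed.

(** By [pell_mul_mod], y_(iq) is q y_i modulo y_i^2 up to a factor prime to y_i.  This
    step of Matiyasevich's argument makes a value of the sequence divide an index. *)
Lemma dvd_of_py_sqr_dvd i n : (0 < i)%N -> (py a i ^+ 2 %| py a n)%Z -> (py a i %| n%:Z)%Z.
Proof.
move=> i_gt0 dv; have y_gt0 : py a i != 0 by have := pell_ge i; lia.
have : (i %| n)%N by apply/py_dvd/(dvdz_trans _ dv)/dvdz_mulr.
case/dvdnP => q Eq; have [_] := pell_mul_mod i q.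
rewrite mulnC -Eq => dv'; rewrite Eq PoszM dvdz_mulr //.
have : (py a i ^+ 2 %| q%:Z * px a i ^+ q * py a i)%Z.
  by rewrite -(subKr (px a i * py a n) (_ * py a i)) rpredB // dvdz_mull.
rewrite expr2 dvdz_mul2r // Gauss_dvdzl //.
by apply: coprimezXr; rewrite coprimez_sym; apply: coprime_pell.
Qed.

Lemma py_sqr_dvd_mul i : (py a i ^+ 2 %| py a (i * `|py a i|))%Z.
Proof.
have [_ dv] := pell_mul_mod i `|py a i|%N.
have cop : coprimez (py a i ^+ 2) (px a i).
  by apply: coprimezXl; rewrite coprimez_sym; apply: coprime_pell.
rewrite -(Gauss_dvdzr _ cop) -(subrK (`|py a i|%N%:Z * px a i ^+ `|py a i| * py a i) (_ * _)).
have yE : `|py a i|%N%:Z = py a i by have := pell_ge i; lia.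
rewrite rpredD // yE; apply/dvdzP; exists (px a i ^+ `|py a i|).
by move: (_ ^+ `|_|) => z; ring.
Qed.

(** Reflections of the index at n bring it below n, and change x only by a sign
    modulo x_n. *)
Lemma px_reduce n j : (0 < n)%N -> exists i, [/\ (i <= n)%N,
  (px a n %| px a j - px a i)%Z \/ (px a n %| px a j + px a i)%Z &
  ((2 * n)%N%:Z %| j%:Z - i%:Z)%Z \/ ((2 * n)%N%:Z %| j%:Z + i%:Z)%Z].
Proof.
move=> n_gt0; have [m] := ubnP j; elim: m => // m IHm in j *; rewrite ltnS => j_m.
have [j_n|n_j] := leqP j n.
  by exists j; rewrite !subrr !dvdz0; split=> //; left.
have [k [k_j dvk dvx]] : exists k, [/\ (k < j)%N,
    ((2 * n)%N%:Z %| j%:Z - k%:Z)%Z \/ ((2 * n)%N%:Z %| j%:Z + k%:Z)%Z &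
    (px a n %| px a j + px a k)%Z].
  have [j_2n|n2_j] := leqP j (2 * n).
    exists (2 * n - j)%N; split; first lia.
      by right; apply/dvdzP; exists 1; lia.
    have := px_chord a (j - n) (2 * n - j).
    rewrite (_ : _ + 2 * _ = j)%N 1?(_ : _ + (_ - n) = n)%N; try lia.
    by move=> ->; rewrite dvdz_mulr // dvdz_mull.
  exists (j - 2 * n)%N; split; first lia.
    by left; apply/dvdzP; exists 1; lia.
  have := px_chord a n (j - 2 * n); rewrite (_ : _ + 2 * _ = j)%N; last lia.
  by move=> ->; rewrite dvdz_mull.
have [|i [i_n dvi dvi']] := IHm k; first lia.
exists i; split=> //.
  case: dvi => dvi; [right|left].
    by apply: dvdzB_eq dvx dvi; ring.
  by apply: dvdzB_eq dvx dvi; ring.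
case: dvk dvi' => [dvk|dvk] [dvi'|dvi'].
- by left; apply: dvdzD_eq dvk dvi'; lia.
- by right; apply: dvdzD_eq dvk dvi'; lia.
- by right; apply: dvdzB_eq dvk dvi'; lia.
- by left; apply: dvdzB_eq dvk dvi'; lia.
Qed.

(** The complementary step of Matiyasevich's argument: a congruence between values,
    modulo x_n, determines the index up to sign modulo 2 n.  Indices not above n have
    distinct values up to sign by [px_lt]. *)
Lemma px_congr_index i n j : (0 < n)%N -> (i <= n)%N -> (px a n %| px a j - px a i)%Z ->
  ((2 * n)%N%:Z %| j%:Z - i%:Z)%Z \/ ((2 * n)%N%:Z %| j%:Z + i%:Z)%Z.
Proof.
move=> n_gt0 i_n dv; have [k [k_n dvk dvj]] := px_reduce j n_gt0.
suff -> : i = k by [].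
have {dvk} dvk : (px a n %| px a i - px a k)%Z \/ (px a n %| px a i + px a k)%Z.
  case: dvk => dvk; [left|right].
    by apply: dvdzB_eq dvk dv; ring.
  by apply: dvdzB_eq dvk dv; ring.
have [k_lt|n_k] := ltnP k n; last first.
  have {n_k} Ek : k = n by lia.
  apply: etrans (esym Ek); apply: px_dvd_eq => //.
  by case: dvk; rewrite Ek => dvk; [apply: dvdzD_eq dvk (dvdzz _)|
    apply: dvdzB_eq dvk (dvdzz _)]; ring.
have [i_lt|n_i] := ltnP i n; last first.
  have {n_i} Ei : i = n by lia.
  rewrite Ei; apply/esym/px_dvd_eq => //.
  by case: dvk; rewrite Ei => dvk; [apply: dvdzB_eq (dvdzz _) dvk|
    apply: dvdzB_eq dvk (dvdzz _)]; ring.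
have {dvk} Ex : px a i = px a k \/ i = 0%N /\ k = 0%N.
  have [? ?] := pell_ge i; have [? ?] := pell_ge k.
  have := px_lt i_lt; have := px_lt k_lt.
  by case: dvk => /dvdz_small; clear dv dvj; lia.
case: Ex => [|[-> ->]] // Ex.
exact: px_inj.
Qed.

End Base.

Lemma pell_congr (c a b : int) n : (c %| b - a)%Z ->
  (c %| px b n - px a n)%Z /\ (c %| py b n - py a n)%Z.
Proof.
case/dvdzP => q Eq; have -> : b = a + q * c by rewrite -Eq; ring.
elim: n => [|n [/dvdzP[s Es] /dvdzP[t Et]]]; first by rewrite !subrr !dvdz0.
have {}Es : px (a + q * c) n = px a n + s * c by rewrite -Es; ring.
have {}Et : py (a + q * c) n = py a n + t * c by rewrite -Et; ring.
rewrite !pxS !pyS Es Et; split; apply/dvdzP.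
  exists (a * s + q * px a n + q * c * s + (a ^+ 2 - 1) * t
    + (2 * a * q + q * q * c) * (py a n + t * c)); ring.
by exists (s + a * t + q * (py a n + t * c)); ring.
Qed.

(** For a = 1 the sequence y is the identity, and congruent parameters give
    congruent values. *)
Lemma py_congr_index (a : int) n : (a - 1 %| py a n - n%:Z)%Z.
Proof.
have -> : n%:Z = py 1 n.
  elim: n => // n IHn; rewrite pyS -IHn.
  suff -> : px 1 n = 1 by lia.
  by elim: n {IHn} => // n IHn; rewrite pxS IHn expr1n subrr mul0r.
by have [] := @pell_congr (a - 1) 1 a n (dvdzz _).
Qed.

(** The number c is a root of t^2 - 2 a t + 1 modulo 2 a c - c^2 - 1, so its powers
    satisfy the same recurrence as the solutions of the Pell equation. *)
Lemma pell_congr_exp (a c : int) n :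
  (2 * a * c - c ^+ 2 - 1 %| px a n - (a - c) * py a n - c ^+ n)%Z.
Proof.
elim: n => [|n /dvdzP[q Eq]]; first by rewrite /= mulr0 subr0 expr0 subrr dvdz0.
have {}Eq : px a n = (a - c) * py a n + c ^+ n + q * (2 * a * c - c ^+ 2 - 1).
  by rewrite -Eq; ring.
rewrite pxS pyS Eq [c ^+ n.+1]exprS; apply/dvdzP.
by exists (py a n + c * q); ring.
Qed.

Lemma eqmod_dvdz (m n d : nat) : m = n %[mod d] <-> (d%:Z %| m%:Z - n%:Z)%Z.
Proof.
rewrite -eqz_mod_dvd !modz_nat; split=> [->//|/eqP[]//].
Qed.

(** Here (x, y), (u, v) and (s, t) are solutions of Pell equations, the first two
    for the parameter a and the third for a parameter b congruent to a modulo u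
    and to 1 modulo 2 y.  The index of (x, y) is compared with k through the index
    of (s, t): the value of s controls it, up to sign, modulo twice the index
    of (u, v), which y divides, and the value of t controls it modulo 2 y. *)
Definition pell_conditions (a k x y : nat) (w : (nat * nat) * (nat * nat) * (nat * nat)) :=
  let: ((u, v), (s, t), (b, r)) := w in
  [/\ x * x + y * y = 1 + (a * a) * (y * y),
      u * u + v * v = 1 + (a * a) * (v * v),
      s * s + t * t = 1 + (b * b) * (t * t) &
   [/\ v = 2 * r.+1 * (y * y),
      b + a * (u * u) = a + (u * u) * (u * u),
      s = x %[mod u],
      t = k %[mod 2 * y] & k <= y]]%N.

Lemma pell_solution (a x y : nat) : (1 < a)%N ->
  (x * x + y * y = 1 + (a * a) * (y * y))%N ->
  exists n, pell a n = (x%:Z, y%:Z).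
Proof.
move=> a_gt1 E; have [||||n En] := @pell_complete a _ x y; try lia.
by exists n.
Qed.

(** This is where v is required to be a multiple of 2 y: it makes u^2, and then b,
    congruent to 1. *)
Lemma pell_modulus (a u v b r y : nat) :
  (u * u + v * v = 1 + (a * a) * (v * v))%N ->
  (v = 2 * r.+1 * (y * y))%N ->
  (b + a * (u * u) = a + (u * u) * (u * u))%N ->
  ((2 * y)%N%:Z %| b%:Z - 1)%Z.
Proof.
move=> Euv Ev Eb.
apply/dvdzP; exists ((a%:Z ^+ 2 - 1) * v%:Z * (r.+1)%:Z * y%:Z * (u%:Z ^+ 2 + 1 - a%:Z)).
have -> : b%:Z - 1 = (u%:Z ^+ 2 - 1) * (u%:Z ^+ 2 + 1 - a%:Z) by clear -Eb; lia.
have -> : u%:Z ^+ 2 - 1 = (a%:Z ^+ 2 - 1) * v%:Z * v%:Z by clear -Euv; lia.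
by rewrite {2}Ev !PoszM; ring.
Qed.

(** Let i, n, j be the indices of (x, y), (u, v), (s, t).  Then j is congruent to
    i or to - i modulo 2 y, and to k modulo 2 y.  As i and k are positive and at
    most y, they are equal. *)
Lemma pell_definable_sound (a k x y : nat) w : (1 < a)%N -> (0 < k)%N ->
  pell_conditions a k x y w -> pell a k = (x%:Z, y%:Z).
Proof.
case: w => [[[u v] [s t]] [b r]] a_gt1 k_gt0 [Exy Euv Est [Ev Eb Es Et k_y]].
have aZ : 1 < a%:Z by lia.
have [i Ei] := pell_solution a_gt1 Exy.
have [n En] := pell_solution a_gt1 Euv.
have i_gt0 : (0 < i)%N by case: i Ei => // -[]; lia.
have n_gt0 : (0 < n)%N by case: n En => // -[]; nia.
have u_ge : (a <= u)%N.
  have := pxS a n.-1; rewrite prednK // En /= => Eu.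
  suff : a%:Z <= u%:Z by lia.
  by rewrite Eu; have [] := pell_ge aZ n.-1; clear -a_gt1; nia.
have u_gt0 : (0 < u)%N := leq_trans (ltnW a_gt1) u_ge.
have b_gt1 : (1 < b)%N.
  have : (a * (u * u) <= (u * u) * (u * u))%N.
    by rewrite leq_mul2r (leq_trans u_ge) ?orbT // leq_pmulr.
  by clear -Eb a_gt1; lia.
have [j Ej] := pell_solution b_gt1 Est.
have i_y : (i <= y)%N by have [] := pell_ge aZ i; rewrite Ei.
have y_n : (y %| n)%N.
  have := @dvd_of_py_sqr_dvd a aZ i n i_gt0; rewrite Ei En /=; apply.
  by apply/dvdzP; exists (2 * (r.+1)%:Z); rewrite Ev !PoszM; ring.
have dv_ji : (u%:Z %| px a j - px a i)%Z.
  have [dv _] : (u%:Z %| px b j - px a j)%Z /\ (u%:Z %| py b j - py a j)%Z.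
    apply: pell_congr; apply/dvdzP; exists (u%:Z * (u%:Z ^+ 2 - a%:Z)).
    by have: b%:Z = a%:Z + u%:Z ^+ 2 * (u%:Z ^+ 2 - a%:Z) by [clear -Eb; lia]; move=> ->; ring.
  move/eqmod_dvdz : Es => Es; apply: dvdzB_eq Es dv.
  by rewrite Ej Ei /=; ring.
have dv_jk : ((2 * y)%N%:Z %| k%:Z - j%:Z)%Z.
  have dv := py_congr_index b j; move/eqmod_dvdz: Et; rewrite Ej /= in dv => dv'.
  have dvb := pell_modulus Euv Ev Eb.
  by apply: dvdzB_eq (dvdz_trans dvb dv) dv'; ring.
suff Ek : k = i by rewrite Ek.
have := @px_congr_index a aZ i n j n_gt0.
rewrite En /= => /(_ (leq_trans i_y (dvdn_leq n_gt0 y_n)) dv_ji).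
have dv2 : ((2 * y)%N%:Z %| (2 * n)%N%:Z)%Z by rewrite !PoszM; apply: dvdz_mul (dvdzz _) _.
case=> /(dvdz_trans dv2) dv3; clear -dv3 dv_jk i_gt0 i_y k_gt0 k_y.
  have /dvdz_small : ((2 * y)%N%:Z %| k%:Z - i%:Z)%Z by apply: dvdzD_eq dv_jk dv3; ring.
  by clear dv3 dv_jk; lia.
have : ((2 * y)%N%:Z %| (k%:Z + i%:Z) - (2 * y)%N%:Z)%Z.
  by apply: dvdzB_eq (dvdzz _); [reflexivity|apply: dvdzD_eq dv_jk dv3; ring].
by move/dvdz_small; clear dv3 dv_jk; lia.
Qed.

(** The index of (u, v) is 2 k y: then y_(2ky) = 2 x_(ky) y_(ky), and y_k^2
    divides y_(ky).  The parameter b is a + u^2 (u^2 - a), an explicit solution of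
    the two congruences that it has to satisfy. *)
Lemma pell_definable_complete (a k x y : nat) : (1 < a)%N -> (0 < k)%N ->
  pell a k = (x%:Z, y%:Z) -> exists w, pell_conditions a k x y w.
Proof.
move=> a_gt1 k_gt0 Exy; have aZ : 1 < a%:Z by lia.
have nat_of m (c : int) : 1 < c -> exists z t : nat, pell c m = (z%:Z, t%:Z).
  move=> c_gt1; have [] := pell_ge c_gt1 m; case: (pell c m) => p q /= ? ?.
  by exists `|p|%N, `|q|%N; congr (_, _); lia.
have [y_k x_1] := pell_ge aZ k; rewrite Exy /= in y_k x_1.
have [z [v1 E1]] := nat_of (k * y)%N a aZ.
have [u [v Euv]] := nat_of (k * y + k * y)%N a aZ.
have [r Ev] : exists r, v = (2 * r.+1 * (y * y))%N.
  have := py_sqr_dvd_mul aZ k; rewrite Exy E1 /= => /dvdzP[q Eq].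
  have := (pell_add a (k * y) (k * y)).2; rewrite Euv E1 /= => Ev.
  have [_ z_ge1] := pell_ge aZ (k * y); rewrite E1 /= in z_ge1.
  have v1_gt0 : 0 < v1%:Z by have [] := pell_ge aZ (k * y)%N; rewrite E1 /=; nia.
  have q_gt0 : 0 < q by nia.
  by exists (z * `|q| - 1)%N; nia.
have norm (c p q m : nat) : pell c%:Z m = (p%:Z, q%:Z) ->
    (p * p + q * q = 1 + (c * c) * (q * q))%N.
  by move=> E; have := pell_norm c m; rewrite E /= ; clear; lia.
have u_gt0 : (0 < u)%N by have [_] := pell_ge aZ (k * y + k * y)%N; rewrite Euv.
have Nuv := norm _ _ _ _ Euv.
have aU : (a <= u * u)%N.
  have v_gt0 : (0 < v)%N by rewrite Ev !muln_gt0 /=; clear -y_k k_gt0; lia.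
  have a_le : (a <= a * a)%N by rewrite leq_pmulr // ltnW.
  have v2_gt0 : (0 < v * v)%N by rewrite muln_gt0 v_gt0.
  have := leq_pmulr (a * a - 1) v2_gt0; rewrite mulnBl.
  by clear -Nuv a_gt1 a_le; lia.
set b := (a + (u * u) * (u * u - a))%N.
have Eb : (b + a * (u * u) = a + (u * u) * (u * u))%N.
  by rewrite /b -addnA (mulnC a) -mulnDr subnK.
have b_gt1 : (1 < b)%N by rewrite ltn_addr.
have [s [t Est]] := nat_of k b (b_gt1 : 1 < b%:Z).
exists ((u, v), (s, t), (b, r)); split; [exact: norm Exy|exact: norm Euv|exact: norm Est|].
split=> //.
- apply/eqmod_dvdz; have [dv _] : (u%:Z %| px b k - px a k)%Z /\ (u%:Z %| py b k - py a k)%Z.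
    apply: pell_congr; apply/dvdzP; exists (u%:Z * (u%:Z ^+ 2 - a%:Z)).
    by have: b%:Z = a%:Z + u%:Z ^+ 2 * (u%:Z ^+ 2 - a%:Z) by [clear -Eb; lia]; move=> ->; ring.
  by rewrite Est Exy in dv.
- apply/eqmod_dvdz; have dv := py_congr_index b k; rewrite Est /= in dv.
  apply: dvdz_trans dv; exact: pell_modulus Nuv Ev Eb.
Qed.

End Pell.

(** * Diophantine relations and exponentiation *)

(** Polynomials with natural coefficients; subtraction is avoided by writing both
    sides of an equation. *)
Inductive expr := EVar of nat | ECst of nat | EAdd of expr & expr | EMul of expr & expr.

Fixpoint eval (v : nat -> nat) (t : expr) : nat :=
  match t with
  | EVar i => v i
  | ECst c => c
  | EAdd t1 t2 => eval v t1 + eval v t2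
  | EMul t1 t2 => eval v t1 * eval v t2
  end.

Fixpoint rename (s : nat -> nat) (t : expr) : expr :=
  match t with
  | EVar i => EVar (s i)
  | ECst c => ECst c
  | EAdd t1 t2 => EAdd (rename s t1) (rename s t2)
  | EMul t1 t2 => EMul (rename s t1) (rename s t2)
  end.

Lemma eval_rename s v t : eval v (rename s t) = eval (fun i => v (s i)) t.
Proof. by elim: t => //= t1 -> t2 ->. Qed.

Lemma eq_eval v w t : v =1 w -> eval v t = eval w t.
Proof. by move=> vw; elim: t => //= t1 -> t2 ->. Qed.

Definition satisfies (v : nat -> nat) (sys : seq (expr * expr)) :=
  all (fun p => eval v p.1 == eval v p.2) sys.

Definition rename_sys s (sys : seq (expr * expr)) :=
  [seq (rename s p.1, rename s p.2) | p <- sys].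

Lemma satisfies_rename s v sys : satisfies v (rename_sys s sys) = satisfies (fun i => v (s i)) sys.
Proof. by rewrite /satisfies all_map; apply: eq_all => p /=; rewrite !eval_rename. Qed.

Lemma eq_satisfies v w sys : v =1 w -> satisfies v sys = satisfies w sys.
Proof. by move=> vw; apply: eq_all => p /=; rewrite !(eq_eval _ vw). Qed.

(** Even positions carry the parameters of a relation, odd positions its
    existential unknowns, so that infinitely many names of each kind remain
    available. *)
Definition interleave (v e : nat -> nat) (i : nat) := if odd i then e i./2 else v i./2.

Lemma interleave_even v e i : interleave v e i.*2 = v i.
Proof. by rewrite /interleave odd_double doubleK. Qed.

Lemma interleave_odd v e i : interleave v e i.*2.+1 = e i.
Proof. by rewrite /interleave /= odd_double uphalf_double. Qed.

Variant half_spec : nat -> Type :=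
| HalfEven i : half_spec i.*2
| HalfOdd i : half_spec i.*2.+1.

Lemma halfP i : half_spec i.
Proof.
by rewrite -[i]odd_double_half; case: (odd i); [apply: HalfOdd | apply: HalfEven].
Qed.

Definition polyn (f : (nat -> nat) -> nat) := exists t, forall v, eval v t = f v.

(** Parameters and unknowns are sequences rather than tuples, so that all the
    closure properties amount to renamings of variables. *)
Definition dioph (R : (nat -> nat) -> Prop) :=
  exists sys, forall v, R v <-> exists e, satisfies (interleave v e) sys.

Lemma polyn_var i : polyn (fun v => v i). Proof. by exists (EVar i). Qed.
Lemma polyn_cst c : polyn (fun=> c). Proof. by exists (ECst c). Qed.
Lemma polyn_add f g : polyn f -> polyn g -> polyn (fun v => f v + g v).
Proof. by case=> t Et [u Eu]; exists (EAdd t u) => v /=; rewrite Et Eu. Qed.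
Lemma polyn_mul f g : polyn f -> polyn g -> polyn (fun v => f v * g v).
Proof. by case=> t Et [u Eu]; exists (EMul t u) => v /=; rewrite Et Eu. Qed.
Lemma polyn_succ f : polyn f -> polyn (fun v => (f v).+1).
Proof. by case=> t Et; exists (EAdd (ECst 1) t) => v /=; rewrite Et. Qed.
Lemma polyn_rename s f : polyn f -> polyn (fun v => f (fun i => v (s i))).
Proof. by case=> t Et; exists (rename s t) => v; rewrite eval_rename. Qed.

Lemma polyn_sum (I : Type) (r : seq I) (F : I -> (nat -> nat) -> nat) :
  (forall i, polyn (F i)) -> polyn (fun v => \sum_(i <- r) F i v).
Proof.
move=> polF; elim: r => [|i r [t Et]]; first by exists (ECst 0) => v; rewrite big_nil.
have [u Eu] := polF i; exists (EAdd u t) => v.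
by rewrite /= Et Eu big_cons.
Qed.

Lemma dioph_ext R S : (forall v, R v <-> S v) -> dioph R -> dioph S.
Proof. by move=> RS [sys Rsys]; exists sys => v; rewrite -RS. Qed.

Lemma dioph_eq f g : polyn f -> polyn g -> dioph (fun v => f v = g v).
Proof.
move=> [t Et] [u Eu]; exists [:: (rename double t, rename double u)] => v.
have E e x : eval (interleave v e) (rename double x) = eval v x.
  by rewrite eval_rename; apply: eq_eval => i; apply: interleave_even.
rewrite /satisfies /=; split=> [fg|[e]]; first by exists v; rewrite !E Et Eu fg eqxx.
by rewrite !E Et Eu andbT => /eqP.
Qed.

Lemma dioph_and R S : dioph R -> dioph S -> dioph (fun v => R v /\ S v).
Proof.
move=> [sys Rsys] [sys' Ssys'].
pose left_var i := if odd i then i./2.*2.*2.+1 else i.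
pose right_var i := if odd i then i./2.*2.+1.*2.+1 else i.
have Eleft v e e' : (fun i => interleave v (interleave e e') (left_var i)) =1 interleave v e.
  move=> i; rewrite /left_var; case: (halfP i) => j; rewrite ?odd_double ?interleave_even //.
  by rewrite /= odd_double /= uphalf_double !interleave_odd interleave_even.
have Eright v e e' : (fun i => interleave v (interleave e e') (right_var i)) =1 interleave v e'.
  move=> i; rewrite /right_var; case: (halfP i) => j; rewrite ?odd_double ?interleave_even //.
  by rewrite /= odd_double /= uphalf_double !interleave_odd.
exists (rename_sys left_var sys ++ rename_sys right_var sys') => v.
rewrite Rsys Ssys'; split=> [[[e He] [e' He']]|[e He]].
  exists (interleave e e'); rewrite /satisfies all_cat -!/(satisfies _ _) !satisfies_rename.
  by rewrite (eq_satisfies _ (Eleft v e e')) (eq_satisfies _ (Eright v e e')) He.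
move: He; have Ee : e =1 interleave (fun i => e i.*2) (fun i => e i.*2.+1).
  by move=> i; case: (halfP i) => j; rewrite ?interleave_even ?interleave_odd.
rewrite (functional_extensionality _ _ Ee) /satisfies all_cat -!/(satisfies _ _) !satisfies_rename.
rewrite (eq_satisfies _ (Eleft v _ _)) (eq_satisfies _ (Eright v _ _)).
by case/andP=> ? ?; split; eexists; eauto.
Qed.

(** A whole sequence can be quantified at once, because a system mentions only
    finitely many of its terms.  The unknowns of the system and the terms of the
    sequence are interleaved once more to become the new unknowns. *)
Lemma dioph_exenv (R : (nat -> nat) -> (nat -> nat) -> Prop) :
  dioph (fun w => R (fun i => w i.*2.+1) (fun i => w i.*2)) ->
  dioph (fun v => exists e, R e v).
Proof.
case=> sys Rsys.
pose s i := if odd i then i./2.*2.+1.*2.+1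
            else if odd i./2 then i./2./2.*2.*2.+1 else i./2./2.*2.
have Es v e e' : (fun i => interleave v (interleave e e') (s i)) =1 interleave (interleave v e) e'.
  move=> i; rewrite /s; case: (halfP i) => j; last first.
    by rewrite /= odd_double /= uphalf_double !interleave_odd.
  rewrite odd_double doubleK interleave_even; case: (halfP j) => k.
    by rewrite odd_double doubleK !interleave_even.
  by rewrite /= odd_double /= uphalf_double !interleave_odd interleave_even.
have {}Rsys e v : R e v <-> exists e', satisfies (interleave (interleave v e) e') sys.
  rewrite -(Rsys (interleave v e)).
  have -> : (fun i => interleave v e i.*2.+1) = e.
    by apply: functional_extensionality => i; apply: interleave_odd.
  suff -> : (fun i => interleave v e i.*2) = v by [].
  by apply: functional_extensionality => i; apply: interleave_even.
exists (rename_sys s sys) => v; split=> [[e /Rsys[e' H]]|[e]].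
  by exists (interleave e e'); rewrite satisfies_rename (eq_satisfies _ (Es v e e')).
rewrite satisfies_rename => H; exists (fun i => e i.*2); apply/Rsys; exists (fun i => e i.*2.+1).
rewrite -(eq_satisfies _ (Es v _ _)); congr (satisfies _ _): H.
apply: functional_extensionality => i; congr (interleave v _ _).
apply: functional_extensionality => j.
by case: (halfP j) => k; rewrite ?interleave_even ?interleave_odd.
Qed.

Lemma dioph_ex (R : nat -> (nat -> nat) -> Prop) :
  dioph (fun w => R (w 1) (fun i => w i.*2)) -> dioph (fun v => exists x, R x v).
Proof.
move=> D; apply: (@dioph_ext (fun v => exists e, R (e 0) v)); last exact: dioph_exenv.
by move=> v; split=> [[e ?]|[x ?]]; [exists (e 0)|exists (fun=> x)].
Qed.

Ltac prove_polyn := repeat first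
  [ exact: polyn_var | exact: polyn_cst | assumption | apply: polyn_rename
  | apply: polyn_succ | apply: polyn_add | apply: polyn_mul ].

Lemma dioph_leq f g : polyn f -> polyn g -> dioph (fun v => f v <= g v).
Proof.
move=> Pf Pg; apply: (@dioph_ext (fun v => exists x, f v + x = g v)).
  move=> v; split=> [[x <-]|le_fg]; first exact: leq_addr.
  by exists (g v - f v); rewrite subnKC.
by apply: dioph_ex; apply: dioph_eq; prove_polyn.
Qed.

Lemma dioph_eqmod f g h : polyn f -> polyn g -> polyn h ->
  dioph (fun v => f v = g v %[mod h v]).
Proof.
move=> Pf Pg Ph.
apply: (@dioph_ext (fun v => exists p q, f v + p * h v = g v + q * h v)); last first.
  by do 2! [apply: dioph_ex]; apply: dioph_eq; prove_polyn.
move=> v; split=> [[p [q E]]|E].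
  by rewrite -(modnMDl p) addnC E addnC modnMDl.
exists (g v %/ h v), (f v %/ h v).
by rewrite {1}(divn_eq (f v) (h v)) {2}(divn_eq (g v) (h v)) E; lia.
Qed.

Ltac prove_dioph := repeat first
  [ apply: dioph_and | apply: dioph_eqmod | apply: dioph_leq | apply: dioph_ex
  | apply: dioph_eq ]; prove_polyn.

(** The side conditions make the relation false outside of the range where the
    characterization by [pell_conditions] is valid. *)
Definition is_pell (a k x y : nat) : Prop :=
  [/\ 1 < a, 0 < k & pell a k = (x%:Z, y%:Z)%R].

Lemma dioph_pell a k x y : polyn a -> polyn k -> polyn x -> polyn y ->
  dioph (fun v => is_pell (a v) (k v) (x v) (y v)).
Proof.
move=> Pa Pk Px Py.
apply: (@dioph_ext (fun v => (1 < a v /\ 0 < k v) /\ exists u v' s t b r,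
  (((x v * x v + y v * y v = 1 + (a v * a v) * (y v * y v)) /\
   (u * u + v' * v' = 1 + (a v * a v) * (v' * v'))) /\
   (s * s + t * t = 1 + (b * b) * (t * t) /\ v' = 2 * r.+1 * (y v * y v))) /\
   ((b + a v * (u * u) = a v + (u * u) * (u * u) /\
    s = x v %[mod u]) /\ (t = k v %[mod 2 * y v] /\ k v <= y v)))); last first.
  by prove_dioph.
move=> v; split.
  case=> -[a1 k0] [u [v' [s [t [b [r [[[? ?] [? ?]] [[? ?] [? ?]]]]]]]]]; split=> //.
  by apply: (@pell_definable_sound _ _ _ _ (u, v', (s, t), (b, r))).
case=> a1 k0 /(pell_definable_complete a1 k0)[[[[u v'] [s t]] [b r]] H].
by case: H => ? ? ? [? ? ? ? ?]; split=> //; exists u, v', s, t, b, r.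
Qed.

Lemma is_pell_exists a k : 1 < a -> 0 < k -> exists x y, is_pell a k x y.
Proof.
move=> a_gt1 k_gt0; have [] := @pell_ge a a_gt1 k.
case E: (pell a k) => [p q] /= ? ?; exists `|p|, `|q|; split=> //.
by rewrite E; congr (_, _); lia.
Qed.

Lemma expn_le_py (a : int) k : (1 < a -> a ^+ k <= (pell a k.+1).2)%R.
Proof.
move=> a_gt1; elim: k => [|k IHk]; first by rewrite pyS expr0 /= mulr0 addr0.
rewrite pyS exprS; have [_] := pell_ge a_gt1 k.+1.
have : (a * a ^+ k <= a * (pell a k.+1).2)%R by rewrite ler_pM2l //; lia.
by lia.
Qed.

(** By [pell_congr_exp], x_k - (A - n) y_k is congruent to n^k modulo
    2 A n - n^2 - 1.  This determines n^k as soon as the modulus is larger; the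
    parameter A = y_(k+1)(n) + n is large enough because y_(k+1)(n) is at least
    n^k, so that the Pell relation itself provides the bound. *)
Lemma expn_pell (n k m : nat) : 1 < n -> 0 < k ->
  m = n ^ k <-> exists z a x y t, [/\ is_pell n k.+1 z a, is_pell (a + n) k x y,
     t + (n * n + 1) = 2 * (a + n) * n, x + n * y = m + (a + n) * y %[mod t] & m < t].
Proof.
move=> n_gt1 k_gt0; have EX : (n%:Z ^+ k = (n ^ k)%:Z)%R by rewrite -!natz natrX.
have main z a x y t : is_pell n k.+1 z a -> is_pell (a + n) k x y ->
    t + (n * n + 1) = 2 * (a + n) * n ->
    n ^ k < t /\ x + n * y = n ^ k + (a + n) * y %[mod t].
  move=> [_ _ Eza] [_ _ Exy] Et; split.
    have := @expn_le_py n k n_gt1; rewrite Eza /= EX.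
    by move=> le_a; clear -le_a Et n_gt1; nia.
  apply/eqmod_dvdz; have := pell_congr_exp (a + n)%N n k; rewrite Exy /=.
  have -> : (t%:Z = 2 * (a + n)%N%:Z * n%:Z - n%:Z ^+ 2 - 1)%R by clear -Et; lia.
  rewrite EX.
  by move=> dv; apply: etrans dv; congr (_ %| _)%Z; lia.
split=> [->|[z [a [x [y [t [pz px Et Em m_t]]]]]]]; last first.
  have [nk_t En] := main _ _ _ _ _ pz px Et.
  have : m = n ^ k %[mod t].
    apply/eqP; rewrite -(eqn_modDr ((a + n) * y)); apply/eqP.
    by rewrite -Em En.
  by rewrite !modn_small.
have [z [a pz]] := is_pell_exists n_gt1 (ltn0Sn k).
have an_gt1 : 1 < a + n by rewrite ltn_addl.
have [x [y px]] := is_pell_exists an_gt1 k_gt0.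
have Et : 2 * (a + n) * n - (n * n + 1) + (n * n + 1) = 2 * (a + n) * n.
  by rewrite subnK //; clear -n_gt1; nia.
have [? ?] := main _ _ _ _ _ pz px Et.
by exists z, a, x, y, (2 * (a + n) * n - (n * n + 1)).
Qed.

(** The relation is reduced to the positive exponent k + 1, which covers k = 0. *)
Lemma dioph_expn n k m : (forall v, 1 < n v) -> polyn n -> polyn k -> polyn m ->
  dioph (fun v => m v = n v ^ k v).
Proof.
move=> n_gt1 Pn Pk Pm.
apply: (@dioph_ext (fun v => exists z a x y t,
  (is_pell (n v) (k v).+2 z a /\ is_pell (a + n v) (k v).+1 x y) /\
   ((t + (n v * n v + 1) = 2 * (a + n v) * n v /\
     x + n v * y = n v * m v + (a + n v) * y %[mod t]) /\ n v * m v < t))).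
  move=> v; have -> : m v = n v ^ k v <-> n v * m v = n v ^ (k v).+1.
    rewrite expnS; split=> [->//|/eqP]; rewrite eqn_pmul2l ?(ltnW (n_gt1 v)) //.
    by move/eqP.
  rewrite expn_pell //; split=> -[z [a [x [y [t]]]]].
    by case=> [[? ?]] [[? ?] ?]; exists z, a, x, y, t.
  by case=> ? ? ? ? ?; exists z, a, x, y, t.
do 5! [apply: dioph_ex]; apply: dioph_and; last by prove_dioph.
by apply: dioph_and; apply: dioph_pell; prove_polyn.
Qed.

(** * Binomial coefficients and inclusion of binary digits *)

Lemma nth_digit_sum (W : nat) (a : nat -> nat) N k : (forall i, a i < W) ->
  ((\sum_(i < N) a i * W ^ i) %/ W ^ k) %% W = if k < N then a k else 0.
Proof.
move=> a_W; have W_gt0 : 0 < W by apply: leq_trans (a_W 0).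
elim: k N a a_W => [|k IHk] [|N] a a_W; rewrite ?big_ord0 ?div0n ?mod0n //.
all: have -> : \sum_(i < N.+1) a i * W ^ i = (\sum_(i < N) a i.+1 * W ^ i) * W + a 0.
1,3: rewrite big_ord_recl muln1 addnC big_distrl /=; congr (_ + _);
  by apply: eq_bigr => i _; rewrite /bump /= expnS mulnCA mulnC.
  by rewrite divn1 modnMDl modn_small.
by rewrite expnS divnMA divnMDl // (divn_small (a_W 0)) addn0 (IHk N (fun i => a i.+1)).
Qed.

Lemma bin_lt_expn n i : 'C(n, i) < 2 ^ n.+1.
Proof.
have le_sum : 'C(n, i) <= 2 ^ n.
  have [i_n|/bin_small-> //] := leqP i n.
  rewrite -[2]/(1 + 1) expnDn; rewrite (bigD1 (Ordinal (i_n : i < n.+1))) //=.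
  by rewrite !exp1n !muln1 leq_addr.
by apply: leq_ltn_trans le_sum _; rewrite ltn_exp2l.
Qed.

(** By the binomial theorem, the coefficients are the digits of (W + 1)^n in base W
    as soon as W exceeds 2^n.  Writing the base as W + 2 keeps it above 1 for every
    value of the unknown, as [dioph_expn] requires. *)
Lemma bin_digit n k c : c = 'C(n, k) <-> exists W w p g h,
  [/\ W.+2 = 2 ^ n.+1, w = W.+2 ^ k, p = W.+3 ^ n,
      p = (g * W.+2 + c) * w + h & h < w /\ c < W.+2].
Proof.
have [W EW] : exists W, W.+2 = 2 ^ n.+1.
  by exists (2 ^ n.+1 - 2); have : 2 ^ 1 <= 2 ^ n.+1 by [rewrite leq_exp2l]; lia.
have key : ((W.+3 ^ n) %/ W.+2 ^ k) %% W.+2 = 'C(n, k).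
  rewrite -[W.+3]/(1 + W.+2) expnDn.
  transitivity ((\sum_(i < n.+1) 'C(n, i) * W.+2 ^ i) %/ W.+2 ^ k %% W.+2).
    by congr (_ %/ _ %% _); apply: eq_bigr => i _; rewrite exp1n mul1n.
  rewrite nth_digit_sum; last by move=> i; rewrite EW bin_lt_expn.
  by case: ltnP => // /bin_small->.
have Wk_gt0 : 0 < W.+2 ^ k by rewrite expn_gt0.
split=> [->|[W' [w [p [g [h [EW' -> -> Ep [h_w c_W]]]]]]]].
  exists W, (W.+2 ^ k), (W.+3 ^ n), (W.+3 ^ n %/ W.+2 ^ k %/ W.+2), (W.+3 ^ n %% W.+2 ^ k).
  split=> //; last by rewrite ltn_pmod // EW bin_lt_expn.
  by rewrite -key -!divn_eq.
have {EW'} EW' : W' = W by move: EW'; rewrite -EW => -[].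
rewrite {W'}EW' in Ep h_w c_W; rewrite -key Ep.
by rewrite divnMDl // (divn_small h_w) addn0 modnMDl modn_small.
Qed.

Lemma dioph_bin n k c : polyn n -> polyn k -> polyn c ->
  dioph (fun v => c v = 'C(n v, k v)).
Proof.
move=> Pn Pk Pc.
apply: (@dioph_ext (fun v => exists W w p g h,
  ((W.+2 = 2 ^ (n v).+1 /\ w = W.+2 ^ k v) /\ (p = W.+3 ^ n v /\
      p = (g * W.+2 + c v) * w + h)) /\ (h < w /\ c v < W.+2))).
  by move=> v; rewrite bin_digit; split=> -[W [w [p [g [h]]]]];
    [case=> -[[? ?] [? ?]]|case=> ? ? ? ?]; exists W, w, p, g, h.
do 5! [apply: dioph_ex]; apply: dioph_and; last by prove_dioph.
apply: dioph_and; apply: dioph_and; do ?[apply: dioph_expn => //]; try by prove_polyn.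
by apply: dioph_eq; prove_polyn.
Qed.

(** Inclusion of the binary digits of x among those of y; [sub_bitsE] relates this
    arithmetical form, due to Lucas, to the digits. *)
Definition sub_bits (x y : nat) : bool := odd 'C(y, x).

Lemma dioph_sub_bits x y : polyn x -> polyn y -> dioph (fun v => sub_bits (x v) (y v)).
Proof.
move=> Px Py; apply: (@dioph_ext (fun v => exists d, d.*2.+1 = 'C(y v, x v))).
  move=> v; rewrite /sub_bits; split=> [[d <-]|odd_bin]; first by rewrite /= odd_double.
  by exists 'C(y v, x v)./2; rewrite -[RHS]odd_double_half odd_bin.
apply: dioph_ex; apply: (@dioph_bin _ _ (fun w => (w 1).*2.+1)); try by prove_polyn.
by exists (EAdd (ECst 1) (EMul (ECst 2) (EVar 1))) => v /=; rewrite mul2n.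
Qed.

(** Modulo 2 the square of 1 + X is 1 + X^2; here the consequence for the
    coefficients is obtained from Pascal's rule. *)
Lemma odd_bin_double n k :
  (odd 'C(n.*2, k.*2) = odd 'C(n, k)) * (odd 'C(n.*2, k.*2.+1) = false).
Proof.
elim: n k => [|n IHn] k; first by case: k.
rewrite doubleS; case: k => [|k].
  by rewrite !bin0 bin1 /= odd_double.
have E1 := IHn k; have [E2 E3] := IHn k.+1; rewrite doubleS in E2 E3.
rewrite doubleS !binS !oddD E2 E3 !E1.1 !E1.2; split; last by case: (odd _).
by rewrite addbF addFb.
Qed.

Lemma odd_bin_bits n k (b a : bool) :
  odd 'C(b + n.*2, a + k.*2) = odd 'C(b, a) && odd 'C(n, k).
Proof.
have E := odd_bin_double n k.
case: a b => [] []; rewrite ?add0n ?add1n ?binS ?oddD ?E.1 ?E.2 ?bin0 ?addFb //.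
case: k {E} => [|k]; first by rewrite !bin0.
by rewrite doubleS binS oddD -doubleS !(odd_bin_double n) addbF.
Qed.

(** Inclusion of bits is tested separately on the two parts of a number cut at the
    digit N; this is what allows histories to be read digit by digit in base 2^N. *)
Lemma sub_bitsE N i r I R : i < 2 ^ N -> r < 2 ^ N ->
  sub_bits (i + 2 ^ N * I) (r + 2 ^ N * R) = sub_bits i r && sub_bits I R.
Proof.
rewrite /sub_bits; elim: N i r I R => [|N IHN] i r I R.
  by rewrite !ltnS !leqn0 => /eqP-> /eqP->; rewrite !mul1n.
rewrite expnS -(odd_double_half i) -(odd_double_half r) => i_lt r_lt.
have E (b : bool) x y : b + x.*2 + 2 * 2 ^ N * y = b + (x + 2 ^ N * y).*2.
  by rewrite doubleD -addnA -!mul2n mulnA.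
rewrite !E !odd_bin_bits IHN ?andbA //; lia.
Qed.

Lemma sub_bits_leq x y : sub_bits x y -> x <= y.
Proof. by apply: contraTT; rewrite -ltnNge /sub_bits => /bin_small->. Qed.

Lemma sub_bits0 y : sub_bits 0 y. Proof. by rewrite /sub_bits bin0. Qed.

Lemma sub_bits_ones m u : u < 2 ^ m -> sub_bits u (2 ^ m - 1).
Proof.
elim: m u => [|m IHm] u; first by rewrite ltnS leqn0 => /eqP->; apply: sub_bits0.
have m_gt0 : 0 < 2 ^ m by rewrite expn_gt0.
rewrite expnS -(odd_double_half u) => u_lt.
have -> : 2 * 2 ^ m - 1 = true + (2 ^ m - 1).*2 by lia.
rewrite /sub_bits odd_bin_bits; apply/andP; split; first by case: (odd u).
by apply: IHm; lia.
Qed.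

(** * Affine rewriting of pairs of numbers *)

Lemma dioph_forall (K : finType) (R : K -> (nat -> nat) -> Prop) :
  (forall k, dioph (R k)) -> dioph (fun v => forall k, R k v).
Proof.
move=> DR; have [s Es] : exists s : seq K, forall k, k \in s.
  by exists (enum K) => k; rewrite mem_enum.
apply: (@dioph_ext (fun v => forall k, k \in s -> R k v)).
  by move=> v; split=> H k; [apply: H | move=> _; apply: H].
elim: s {Es} => [|k s IHs]; first by exists [::] => v; split=> // _; exists (fun=> 0).
apply: dioph_ext (dioph_and (DR k) IHs) => v; split=> [[Rk Rs] i|Rs].
  by rewrite inE => /predU1P[->|/Rs].
by split=> [|i i_s]; apply: Rs; rewrite inE ?eqxx // i_s orbT.
Qed.

(** A family indexed by a finite type is read off a sequence at the ranks of the
    indices. *)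
Lemma dioph_exfun (K : finType) (R : (K -> nat) -> (nat -> nat) -> Prop) :
  dioph (fun w => R (fun k => w (enum_rank k).*2.+1) (fun i => w i.*2)) ->
  dioph (fun v => exists f, R f v).
Proof.
move=> DR.
apply: (@dioph_ext (fun v => exists e : nat -> nat, R (fun k => e (enum_rank k)) v)).
  move=> v; split=> [[e Re]|[f Rf]]; first by eexists; apply: Re.
  exists (fun i => oapp (fun j => f (enum_val j)) 0 (insub i : option 'I_#|K|)); congr (R _ _): Rf.
  by apply: functional_extensionality => k; rewrite valK /= enum_rankK.
exact: dioph_exenv.
Qed.

(** A pair (a, b) stands for the affine function a u + b.  A rule rewrites every
    pair of values of its source functions, at u and v, into the values of its
    target functions at the same u and v. *)
Record rule := Rule {
  src_x : nat * nat; src_y : nat * nat; tgt_x : nat * nat; tgt_y : nat * nat }.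

Definition affine (p : nat * nat) (u : nat) := p.1 * u + p.2.

Lemma digits_inj Q a b a' b' : a < Q -> a' < Q -> a + Q * b = a' + Q * b' -> a = a' /\ b = b'.
Proof.
move=> a_Q a'_Q E; have Q_gt0 : 0 < Q by case: Q a_Q {E a'_Q}.
have := congr1 (modn^~ Q) E; have := congr1 (divn^~ Q) E.
rewrite ![_ + Q * _]addnC ![Q * _]mulnC !modnMDl !divnMDl // !modn_small // !divn_small //.
by rewrite !addn0.
Qed.

Section Rewriting.
Variables (K : finType) (rl : K -> rule).

(** The pairs from which (0, 0) can be reached.  A fixed target (0, 0) makes the
    run end exactly where its encoding runs out of digits. *)
Inductive vanishes : nat -> nat -> Prop :=
| Vanishes0 : vanishes 0 0
| VanishesS k u v : vanishes (affine (tgt_x (rl k)) u) (affine (tgt_y (rl k)) v) ->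
    vanishes (affine (src_x (rl k)) u) (affine (src_y (rl k)) v).

Definition affine_sum (f : rule -> nat * nat) (U I : K -> nat) :=
  \sum_k ((f (rl k)).1 * U k + (f (rl k)).2 * I k).

(** A run of T steps as numbers in base Q: at the digit t, the indicator I k is 1 if
    the rule k is used at the step t, and U k and V k are then the arguments of the
    rule, and 0 otherwise.  R is the number with T digits 1, and p = 2^m - 1 bounds
    the arguments.  The last two equations say that the values of the sources are
    the initial value followed by the values of the targets. *)
Definition history (p Q R x y : nat) (I U V : K -> nat) :=
  [/\ \sum_k I k = R,
      forall k, (sub_bits (I k) R /\ sub_bits (U k) (p * I k)) /\ sub_bits (V k) (p * I k),
      affine_sum src_x U I = x + Q * affine_sum tgt_x U I &
      affine_sum src_y V I = y + Q * affine_sum tgt_y V I].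

Fixpoint repunit (Q T : nat) := if T is T'.+1 then 1 + Q * repunit Q T' else 0.

Lemma repunitP Q T R : 1 < Q -> R = repunit Q T <-> Q ^ T + R = 1 + Q * R.
Proof.
move=> Q_gt1; have E : Q ^ T + repunit Q T = 1 + Q * repunit Q T.
  by elim: T => [|T IHT] //=; rewrite ?muln0 // expnS; nia.
by split=> [->//|E']; nia.
Qed.

Lemma affine_sum_split f U I U' I' Q :
  affine_sum f (fun k => U k + Q * U' k) (fun k => I k + Q * I' k) =
  affine_sum f U I + Q * affine_sum f U' I'.
Proof. by rewrite /affine_sum big_distrr -big_split /=; apply: eq_bigr => k _; lia. Qed.

Lemma affine_sum_single f k0 u :
  affine_sum f (fun k => (k == k0) * u) (fun k => k == k0 : nat) = affine (f (rl k0)) u.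
Proof.
rewrite /affine_sum (bigD1 k0) //= eqxx mul1n muln1 big1 ?addn0 // => k /negPf->.
by rewrite !muln0.
Qed.

Lemma affine_lt p (c m u : nat) : affine p 1 < 2 ^ c -> u < 2 ^ m -> affine p u < 2 ^ (m + c).
Proof.
rewrite /affine muln1 => p_lt u_lt; rewrite addnC expnD.
have : (p.1 + p.2) * 2 ^ m < 2 ^ c * 2 ^ m by rewrite ltn_mul2r expn_gt0.
have : p.1 * u <= p.1 * 2 ^ m by rewrite leq_mul2l ltnW ?orbT.
have : p.2 * 1 <= p.2 * 2 ^ m by rewrite leq_mul2l expn_gt0 orbT.
by rewrite mulnDl; lia.
Qed.

Definition coeff_bound (c : nat) := #|K|.+1 < 2 ^ c /\ forall k,
  (affine (src_x (rl k)) 1 < 2 ^ c /\ affine (src_y (rl k)) 1 < 2 ^ c) /\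
  (affine (tgt_x (rl k)) 1 < 2 ^ c /\ affine (tgt_y (rl k)) 1 < 2 ^ c).

Lemma coeff_bound_exists : exists c, coeff_bound c.
Proof.
(* The sum of all the quantities to be bounded is below 2 to its own power. *)
pose s k := affine (src_x (rl k)) 1 + affine (src_y (rl k)) 1
  + (affine (tgt_x (rl k)) 1 + affine (tgt_y (rl k)) 1).
pose c := #|K|.+1 + \sum_k s k; exists c.
have c_lt : c < 2 ^ c by apply: ltn_expl.
split=> [|k]; first by apply: leq_ltn_trans (leq_addr _ _) c_lt.
have s_k : s k <= c by rewrite /c (bigD1 k) //= addnCA leq_addr.
by have := leq_ltn_trans s_k c_lt; rewrite /s; lia.
Qed.

Variables (c : nat) (c_bound : coeff_bound c).

Lemma history_base_gt m : 1 < 2 ^ (m + c) /\ 2 ^ m - 1 < 2 ^ (m + c).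
Proof.
split.
  apply: (@leq_trans (2 ^ c)); last by rewrite leq_pexp2l // leq_addl.
  by case: c_bound => + _; apply: leq_trans.
by have := leq_pexp2l (isT : 0 < 2) (leq_addr c m); have := expn_gt0 2 m; lia.
Qed.

(** Induction on the number of digits: the lowest digits of the unknowns describe
    the first step, and their quotients by Q describe the rest of the run.  No
    carry occurs, since all digits are smaller than Q. *)
Lemma history_sound m T x y I U V :
  let Q := 2 ^ (m + c) in x < Q -> y < Q ->
  history (2 ^ m - 1) Q (repunit Q T) x y I U V -> vanishes x y.
Proof.
move=> Q; have Q_gt0 : 0 < Q by rewrite expn_gt0.
have Q_ge : 2 ^ c <= Q by rewrite leq_pexp2l // leq_addl.
have [Q_gt1 p_lt] := history_base_gt m; rewrite -/Q in Q_gt1 p_lt.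
elim: T x y I U V => [|T IHT] x y I U V x_Q y_Q [EI bits Ex Ey].
  have I0 k : I k = 0 by apply/eqP; have := bits k; rewrite -leqn0 => -[[/sub_bits_leq]].
  have affine_sum0 f W : (forall k, sub_bits (W k) ((2 ^ m - 1) * I k)) -> affine_sum f W I = 0.
    move=> bitsW; apply: big1 => k _; have := sub_bits_leq (bitsW k).
    by rewrite I0 muln0 leqn0 => /eqP->; rewrite !muln0.
  rewrite affine_sum0 in Ex; last by move=> k; case: (bits k) => -[].
  rewrite affine_sum0 in Ey; last by move=> k; case: (bits k) => -[].
  have -> : x = 0 by lia.
  by have -> : y = 0 by [lia]; exact: Vanishes0.
(* Lowest digit and remaining digits of each unknown. *)
have splitn a : a = a %% Q + Q * (a %/ Q) by rewrite addnC mulnC -divn_eq.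
have split_Q W : W = (fun k : K => W k %% Q + Q * (W k %/ Q)).
  by apply: functional_extensionality => k; apply: splitn.
have lt_modQ a : a %% Q < 2 ^ (m + c) by rewrite ltn_mod.
have bitsI k : I k %% Q <= 1 /\ sub_bits (I k %/ Q) (repunit Q T).
  case: (bits k) => -[+ _] _; rewrite /= {1}(splitn (I k)) (sub_bitsE _ _ (lt_modQ _) Q_gt1).
  by case/andP=> /sub_bits_leq.
have bitsW W : (forall k, sub_bits (W k) ((2 ^ m - 1) * I k)) -> forall k,
    W k %% Q <= (2 ^ m - 1) * (I k %% Q) /\
    sub_bits (W k %/ Q) ((2 ^ m - 1) * (I k %/ Q)).
  move=> H k; have := H k; rewrite {1}(splitn (W k)) {1}(splitn (I k)) mulnDr (mulnCA _ Q).
  have pi_lt : (2 ^ m - 1) * (I k %% Q) < 2 ^ (m + c).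
    apply: leq_ltn_trans p_lt; have [+ _] := bitsI k.
    by case: (I k %% Q) => [|[]] //; rewrite ?muln0 ?muln1.
  by rewrite (sub_bitsE _ _ (lt_modQ _) pi_lt) => /andP[/sub_bits_leq].
have {EI} [EI EI'] : \sum_k I k %% Q = 1 /\ \sum_k I k %/ Q = repunit Q T.
  apply: digits_inj (_ : _ + Q * _ = _) => //; last first.
    by apply: etrans EI; rewrite big_distrr -big_split /=; apply: eq_bigr => k _.
  apply: leq_ltn_trans (_ : #|K| < Q); last first.
    by apply: leq_trans Q_ge; case: c_bound => /ltnW.
  by rewrite -sum1_card; apply: leq_sum => k _; case: (bitsI k).
(* Exactly one rule is used at the first step. *)
have /eqP/sum_nat_eq1[k0 [_ I_k0 I_k]] := EI.
have affine_sum_peel f W : (forall k, sub_bits (W k) ((2 ^ m - 1) * I k)) ->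
    affine_sum f W I =
      affine (f (rl k0)) (W k0 %% Q) + Q * affine_sum f (fun k => W k %/ Q) (fun k => I k %/ Q).
  move=> /bitsW W_bits; rewrite {1}(split_Q W) {1}(split_Q I) affine_sum_split -affine_sum_single.
  congr (affine_sum _ _ _ + _); apply: functional_extensionality => k.
    have [->|k_k0] := eqVneq k k0; first by rewrite mul1n.
    by have [] := W_bits k; rewrite I_k // muln0 leqn0 => /eqP->.
  by have [->|k_k0] := eqVneq k k0; rewrite ?I_k0 // I_k.
have bitsU k : sub_bits (U k) ((2 ^ m - 1) * I k) by case: (bits k) => -[].
have bitsV k : sub_bits (V k) ((2 ^ m - 1) * I k) by case: (bits k) => -[].
have W_lt W : (forall k, sub_bits (W k) ((2 ^ m - 1) * I k)) -> W k0 %% Q < 2 ^ m.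
  by move=> /bitsW/(_ k0)[+ _]; rewrite I_k0 muln1; have := expn_gt0 2 m; lia.
have [_ /(_ k0)[[sx sy] [tx ty]]] := c_bound.
rewrite !(affine_sum_peel _ _ bitsU) in Ex; rewrite !(affine_sum_peel _ _ bitsV) in Ey.
have [<- {}Ex] := digits_inj (affine_lt sx (W_lt _ bitsU)) x_Q Ex.
have [<- {}Ey] := digits_inj (affine_lt sy (W_lt _ bitsV)) y_Q Ey.
apply: VanishesS; apply: (IHT _ _ (fun k => I k %/ Q) (fun k => U k %/ Q) (fun k => V k %/ Q)).
- exact: affine_lt tx (W_lt _ bitsU).
- exact: affine_lt ty (W_lt _ bitsV).
split=> // k; have [_ ?] := bitsI k; have [_ ?] := bitsW _ bitsU k.
by have [_ ?] := bitsW _ bitsV k.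
Qed.

(** The histories are built backwards, one lowest digit at a time.  The size m of
    the digits has to be the same for all the steps, so it is chosen last. *)
Lemma history_complete x y : vanishes x y -> exists m0, forall m, m0 <= m ->
  let Q := 2 ^ (m + c) in
  [/\ x < Q, y < Q & exists T I U V, history (2 ^ m - 1) Q (repunit Q T) x y I U V].
Proof.
elim=> [|k0 u v _ [m0 IH]].
  exists 0 => m _ Q; have Q_gt0 : 0 < Q by rewrite expn_gt0.
  split=> //; exists 0, (fun=> 0), (fun=> 0), (fun=> 0).
  have affine_sum0 f : affine_sum f (fun=> 0) (fun=> 0) = 0 by apply: big1 => k _; rewrite !muln0.
  by split; rewrite ?affine_sum0 ?muln0 ?sum_nat_const ?muln0.
exists (m0 + (u + v)) => m m_ge Q.
have [_ _ [T [I [U [V [EI bits Ex Ey]]]]]] := IH m (leq_trans (leq_addr _ _) m_ge).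
have [Q_gt1 p_lt] := history_base_gt m; rewrite -/Q in Q_gt1 p_lt EI bits Ex Ey.
have small w : w <= u + v -> w < 2 ^ m.
  move=> w_le; apply: leq_ltn_trans (ltn_expl m (isT : 1 < 2)).
  by apply: leq_trans m_ge; apply: leq_trans w_le (leq_addl _ _).
have u_lt := small u (leq_addr _ _); have v_lt := small v (leq_addl _ _).
have [_ /(_ k0)[[sx sy] [tx ty]]] := c_bound.
split; [exact: affine_lt sx u_lt | exact: affine_lt sy v_lt |].
exists T.+1, (fun k => (k == k0) + Q * I k), (fun k => (k == k0) * u + Q * U k),
  (fun k => (k == k0) * v + Q * V k).
have bitsW w W k : w < 2 ^ m -> sub_bits (W k) ((2 ^ m - 1) * I k) ->
    sub_bits ((k == k0) * w + Q * W k) ((2 ^ m - 1) * ((k == k0) + Q * I k)).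
  move=> w_lt W_bits; rewrite mulnDr (mulnCA _ Q).
  have w_Q : (k == k0) * w < Q.
    apply: leq_ltn_trans p_lt; case: eqP; rewrite ?mul0n ?mul1n //.
    by move: (2 ^ m) w_lt => P; lia.
  have p_Q : (2 ^ m - 1) * (k == k0) < Q.
    by apply: leq_ltn_trans p_lt; case: eqP; rewrite ?muln0 ?muln1.
  rewrite (sub_bitsE _ _ w_Q p_Q) W_bits andbT; case: eqP => _; last exact: sub_bits0.
  by rewrite mul1n muln1 sub_bits_ones.
split=> [|k||].
- rewrite big_split -big_distrr /= EI; congr (_ + _).
  by rewrite (bigD1 k0) //= eqxx big1 // => k /negPf->.
- have [[bI bU] bV] := bits k; split; last exact: bitsW.
  split; last exact: bitsW.
  rewrite (@sub_bitsE (m + c) _ 1) ?bI ?andbT //; first by case: eqP.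
  by case: eqP => // _; apply: ltnW.
- by rewrite !affine_sum_split !affine_sum_single Ex.
- by rewrite !affine_sum_split !affine_sum_single Ey.
Qed.

End Rewriting.

Lemma dioph_history (K : finType) (rl : K -> rule) p Q R x y (I U V : K -> (nat -> nat) -> nat) :
  polyn p -> polyn Q -> polyn R -> polyn x -> polyn y ->
  (forall k, polyn (I k)) -> (forall k, polyn (U k)) -> (forall k, polyn (V k)) ->
  dioph (fun v => history rl (p v) (Q v) (R v) (x v) (y v)
                    (fun k => I k v) (fun k => U k v) (fun k => V k v)).
Proof.
move=> Pp PQ PR Px Py PI PU PV.
have Plin f (W : K -> (nat -> nat) -> nat) : (forall k, polyn (W k)) ->
    polyn (fun v => affine_sum rl f (fun k => W k v) (fun k => I k v)).
  by move=> PW; apply: polyn_sum => k; have := PI k; have := PW k; move=> ? ?; prove_polyn.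
apply: (@dioph_ext (fun v => (\sum_k I k v = R v /\ forall k,
    (sub_bits (I k v) (R v) /\ sub_bits (U k v) (p v * I k v)) /\
    sub_bits (V k v) (p v * I k v)) /\
  (affine_sum rl src_x (fun k => U k v) (fun k => I k v)
     = x v + Q v * affine_sum rl tgt_x (fun k => U k v) (fun k => I k v) /\
   affine_sum rl src_y (fun k => V k v) (fun k => I k v)
     = y v + Q v * affine_sum rl tgt_y (fun k => V k v) (fun k => I k v)))).
  by move=> v; split=> [[[? ?] [? ?]]|[? ? ? ?]]; split.
apply: dioph_and; last first.
  by apply: dioph_and; apply: dioph_eq; prove_polyn; apply: Plin.
apply: dioph_and; first by apply: dioph_eq => //; apply: polyn_sum.
apply: dioph_forall => k; have ? := PI k; have ? := PU k; have ? := PV k.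
by do ?[apply: dioph_and]; apply: dioph_sub_bits; prove_polyn.
Qed.

Theorem dioph_vanishes (K : finType) (rl : K -> rule) x y : polyn x -> polyn y ->
  dioph (fun v => vanishes rl (x v) (y v)).
Proof.
move=> Px Py; have [c c_bound] := coeff_bound_exists rl.
apply: (@dioph_ext (fun v => exists m T p q w R,
  (((p.+1 = 2 ^ m /\ q.+2 = 2 ^ (m + c)) /\ (w = q.+2 ^ T /\ w + R = 1 + q.+2 * R)) /\
  (x v < q.+2 /\ y v < q.+2)) /\ exists I U V, history rl p q.+2 R (x v) (y v) I U V)).
  move=> v; split.
    case=> m [T [p [q [w [R [[[[Ep Eq] [-> ER]] [x_q y_q]] [I [U [V H]]]]]]]]].
    have {ER} ER : R = repunit q.+2 T by apply/repunitP.
    rewrite {R}ER Eq in H x_q y_q; have {}Ep : p = 2 ^ m - 1 by rewrite -Ep subn1.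
    by rewrite Ep in H; apply: history_sound H.
  move/(history_complete c_bound) => [m /(_ m (leqnn m))].
  have [Q_gt1 _] := history_base_gt c_bound m; case EQ: (2 ^ (m + c)) Q_gt1 => [|[|q]] // _ /=.
  case=> x_q y_q [T [I [U [V H]]]].
  exists m, T, (2 ^ m - 1), q, (q.+2 ^ T), (repunit q.+2 T); split; last by exists I, U, V.
  split=> //; split; split=> //; first by rewrite subn1 prednK ?expn_gt0.
  by apply/repunitP.
do 6! [apply: dioph_ex]; apply: dioph_and.
  apply: dioph_and; last by prove_dioph.
  apply: dioph_and; apply: dioph_and; do ?[by apply: dioph_expn => //; prove_polyn].
  by prove_dioph.
by do 3! [apply: dioph_exfun]; apply: dioph_history; move=> *; prove_polyn.
Qed.

(** * Turing machines as affine rewriting *)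

Section MachineNumbers.
Variables (A : finType) (M : machine A).

Definition tape_base := #|{: A + work M}|.+1.

(** The blank is the digit 0, so that the blank cells beyond the written part of the
    tape are leading zeros. *)
Definition digit (s : symbol M) : nat := if s is Some z then (enum_rank z).+1 else 0.

Definition half_tape_num (l : seq (symbol M)) : nat :=
  foldr (fun s n => digit s + tape_base * n) 0 l.

Lemma digit_lt s : digit s < tape_base.
Proof. by case: s => [z|] //=; rewrite ltnS; apply: ltn_ord. Qed.

Lemma digit_inj : injective digit.
Proof. by move=> [z|] [z'|] //= [/ord_inj/enum_rank_inj ->]. Qed.

Lemma half_tape_num_head l :
  half_tape_num l = digit (head None l) + tape_base * half_tape_num (behead l).
Proof. by case: l => //=; rewrite muln0. Qed.

Lemma half_tape_num_cat l l' :
  half_tape_num (l ++ l') = half_tape_num l + tape_base ^ size l * half_tape_num l'.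
Proof. by elim: l => [|s l IHl] /=; rewrite ?mul1n // IHl expnS; lia. Qed.

Definition nstates := #|state M|.+1.
(** States are numbered from 1, so that no configuration is (0, 0). *)
Definition state_num (q : state M) := (enum_rank q).+1.

Lemma state_num_lt q : state_num q < nstates.
Proof. by rewrite ltnS; apply: ltn_ord. Qed.

Definition config_nums (c : config M) : nat * nat :=
  let: (q, (l, r)) := c in (state_num q + nstates * half_tape_num l, half_tape_num r).

(** One rule for each state, scanned symbol s and symbol s' to the left of the head.
    In the source, u and v are the halves of the tape without these two cells, so
    that a move in either direction is affine in u and v.  A rejecting state leads
    to (0, 0), and an accepting state to itself. *)
Definition machine_rule (k : state M * option (A + work M) * option (A + work M)) : rule :=
  let: (q, s, s') := k in
  let src_l := (nstates * tape_base, state_num q + nstates * digit s') in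
  let src_r := (tape_base, digit s) in
  match verdict q with
  | Some true => Rule src_l src_r src_l src_r
  | Some false => Rule src_l src_r (0, 0) (0, 0)
  | None =>
    let: (q', a, d) := trans q s in
    match d with
    | ToRight => Rule src_l src_r
        (nstates * tape_base * tape_base,
         state_num q' + nstates * (digit a + tape_base * digit s')) (1, 0)
    | ToLeft => Rule src_l src_r
        (nstates, state_num q') (tape_base * tape_base, digit s' + tape_base * digit a)
    end
  end.

Lemma machine_rule_src q s s' u v :
  let rl := machine_rule (q, s, s') in
  affine (src_x rl) u = state_num q + nstates * (digit s' + tape_base * u) /\
  affine (src_y rl) v = digit s + tape_base * v.
Proof.
have E : src_x (machine_rule (q, s, s')) = (nstates * tape_base, state_num q + nstates * digit s')
      /\ src_y (machine_rule (q, s, s')) = (tape_base, digit s).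
  by rewrite /machine_rule; case: verdict => [[]|] //; case: trans => -[q' a] [].
by case: E => /= -> ->; rewrite /affine; split => /=; lia.
Qed.

Lemma machine_rule_tgt q l r : verdict q = None ->
  let rl := machine_rule (q, head None r, head None l) in
  config_nums (step (q, (l, r))) =
    (affine (tgt_x rl) (half_tape_num (behead l)), affine (tgt_y rl) (half_tape_num (behead r))).
Proof.
move=> vq; rewrite /machine_rule /step vq; case: trans => -[q' a] [] /=.
  by rewrite /affine /=; congr (_, _); ring.
by rewrite /affine /= (half_tape_num_head l); congr (_, _); ring.
Qed.

Lemma vanishes_config c :
  vanishes machine_rule (config_nums c).1 (config_nums c).2 <->
  exists t, verdict (iter t (@step A M) c).1 = Some false.
Proof.
have src q l r : config_nums (q, (l, r)) =
    (affine (src_x (machine_rule (q, head None r, head None l))) (half_tape_num (behead l)),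
     affine (src_y (machine_rule (q, head None r, head None l))) (half_tape_num (behead r))).
  by case: (machine_rule_src q (head None r) (head None l)
    (half_tape_num (behead l)) (half_tape_num (behead r))) => -> ->; rewrite -!half_tape_num_head.
split=> [|[t]].
  move Ex: (config_nums c).1 => x; move Ey: (config_nums c).2 => y H.
  elim: H => {x y} [|[[q s] s'] u v H IH] in c Ex Ey *; case: c => q1 [l r] in Ex Ey *.
    by move: Ex; rewrite /= /state_num; lia.
  have [E1 E2] := machine_rule_src q s s' u v.
  rewrite {}E1 /= in Ex; rewrite {}E2 /= half_tape_num_head in Ey.
  have [/ord_inj/enum_rank_inj Eq El] : (enum_rank q1 = enum_rank q :> nat) /\
      half_tape_num l = digit s' + tape_base * u.
    by have [[]] := digits_inj (state_num_lt q1) (state_num_lt q) Ex.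
  clear Ex; rewrite {q1}Eq; rewrite half_tape_num_head in El.
  have [/digit_inj Es' Eu] := digits_inj (digit_lt _) (digit_lt _) El.
  have [/digit_inj Es Ev] := digits_inj (digit_lt _) (digit_lt _) Ey.
  case vq: (verdict q) => [[]|]; last 2 first.
  - by exists 0.
  - have [t Ht] : exists t, verdict (iter t (@step A M) (step (q, (l, r)))).1 = Some false.
      by apply: IH; rewrite (machine_rule_tgt _ _ vq) Es Es' Eu Ev.
    by exists t.+1; rewrite iterSr.
  by apply: IH; rewrite src Es Es' Eu Ev /machine_rule vq.
elim: t c => [|t IHt] [q [l r]].
  move=> vq; rewrite /= in vq; rewrite src; apply: VanishesS.
  by rewrite /machine_rule vq; apply: Vanishes0.
rewrite iterSr; case vq: (verdict q) => [b|].
  have -> : step (q, (l, r)) = (q, (l, r)) by rewrite /step vq.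
  exact: IHt.
move/IHt; rewrite (machine_rule_tgt _ _ vq) => H.
by rewrite src; apply: VanishesS.
Qed.

End MachineNumbers.

(** * Matrix systems whose unknowns share a diagonal position *)

Section Matrices.
Local Open Scope ring_scope.

Section Evaluation.
Variables (n k : nat) (X : 'I_k -> 'M[int]_n.+1).

Definition monom_eval (m : {fmonom 'I_k}) : 'M[int]_n.+1 := \prod_(i <- (m : seq 'I_k)) X i.

Fact monom_eval_is_mmorphism : mmorphism monom_eval.
Proof.
by split=> [u v|]; rewrite /monom_eval ?fmM ?big_cat // fm1 big_nil.
Qed.
HB.instance Definition _ := monalg.isMultiplicative.Build {fmonom 'I_k} 'M[int]_n.+1
  monom_eval monom_eval_is_mmorphism.

Lemma nceval_mmap P : nceval X P = mmap (@scalar_mx int n.+1) monom_eval P.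
Proof. by []. Qed.

Lemma ncevalB P Q : nceval X (P - Q) = nceval X P - nceval X Q.
Proof. by rewrite !nceval_mmap mmapB. Qed.

Lemma ncevalD P Q : nceval X (P + Q) = nceval X P + nceval X Q.
Proof. by rewrite !nceval_mmap mmapD. Qed.

Lemma ncevalM P Q : nceval X (P * Q) = nceval X P * nceval X Q.
Proof.
rewrite !nceval_mmap; apply: (commr_mmap_is_multiplicative _).1 => g m m'.
exact/esym/scalar_mxC.
Qed.

Lemma nceval_commutator P Q :
  nceval X (P * Q - Q * P) = nceval X P * nceval X Q - nceval X Q * nceval X P.
Proof. by rewrite ncevalB; congr (_ - _); apply: ncevalM. Qed.

Lemma nceval_nat c : nceval X c%:R = c%:R.
Proof.
elim: c => [|c IHc]; first by rewrite nceval_mmap mmap0.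
by rewrite -natr1 ncevalD IHc nceval_mmap mmap1 natr1.
Qed.

Lemma nceval1 : nceval X 1 = 1.
Proof. exact: (nceval_nat 1). Qed.

Lemma nceval_sum (I : finType) (F : I -> ncpoly k) :
  nceval X (\sum_i F i) = \sum_i nceval X (F i).
Proof. by rewrite nceval_mmap raddf_sum. Qed.

Lemma nceval_var i : nceval X << fmu i >> = X i.
Proof. by rewrite nceval_mmap mmapU mul1r /monom_eval fmU big_seq1. Qed.

End Evaluation.

Section Gadget.
Variable n : nat.

(** Entries of the matrices A j are natural numbers with sum the identity, so the
    matrices are diagonal and each diagonal position belongs to exactly one of them.
    Choosing a position of each A j gives an injective, hence bijective, map. *)
Lemma unit_decomposition (A : 'I_n.+1 -> 'M[nat]_n.+1) :
  (forall s s', (\sum_j A j s s' = (s == s'))%N) -> (forall j, exists s s', A j s s' != 0%N) ->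
  exists t, forall s s', A ord0 s s' = ((s == t) && (s' == t)) :> nat.
Proof.
move=> sumA nzA.
have le_sum j s s' : (A j s s' <= (s == s'))%N by rewrite -sumA (bigD1 j) //= leq_addr.
have /fin_all_exists[f f_nz] : forall j, exists s, A j s s != 0%N.
  move=> j; have [s [s' nz]] := nzA j; exists s.
  have [Es|ns] := eqVneq s s'; first by rewrite {2}Es.
  by have := le_sum j s s'; rewrite (negPf ns) leqNgt lt0n nz.
(* Two matrices with a common diagonal position would have a sum above 1 there. *)
have only j j' s : A j s s != 0%N -> A j' s s != 0%N -> j = j'.
  move=> nz nz'; apply/eqP; apply: contraT => j_j'.
  have := sumA s s; rewrite eqxx (bigD1 j) //= (bigD1 j') 1?eq_sym //=.
  by move: nz nz'; rewrite -!lt0n; lia.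
have f_inj : injective f by move=> j j' ff; apply: (only _ _ (f j)); rewrite // ff.
exists (f ord0) => s s'; have [<-|s_s'] := eqVneq s s'; last first.
  have := le_sum ord0 s s'; rewrite (negPf s_s'); case: (A _ _ _) => // _.
  by case: (s =P f ord0) => //= Es; rewrite -Es eq_sym (negPf s_s').
have [g _ fK] := injF_bij f_inj; rewrite andbb -(fK s).
have [e|ne] := eqVneq (g s) ord0.
  rewrite e eqxx; apply/eqP; rewrite eqn_leq lt0n f_nz andbT.
  by have := le_sum ord0 (f ord0) (f ord0); rewrite eqxx.
rewrite (inj_eq f_inj) (negPf ne); apply/eqP; apply: contraNT ne => nz.
by apply/eqP/(only _ _ (f (g s))) => //; rewrite f_nz.
Qed.

End Gadget.

Lemma expr_comparable : comparable expr.
Proof. by move=> t u; rewrite /decidable; decide equality; apply: eq_comparable. Qed.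
HB.instance Definition _ := hasDecEq.Build expr (compareP expr_comparable).

Fixpoint ring_eval (R : nzRingType) (v : nat -> R) (t : expr) : R :=
  match t with
  | EVar i => v i
  | ECst c => c%:R
  | EAdd t1 t2 => ring_eval v t1 + ring_eval v t2
  | EMul t1 t2 => ring_eval v t1 * ring_eval v t2
  end.

Lemma nceval_expr n k (X : 'I_k -> 'M[int]_n.+1) (s : nat -> 'I_k) t :
  nceval X (ring_eval (fun i => << fmu (s i) >> : ncpoly k) t) = ring_eval (fun i => X (s i)) t.
Proof.
by elim: t => /= [i|c|t1 IH1 t2 IH2|t1 IH1 t2 IH2];
  rewrite ?nceval_var ?nceval_nat ?ncevalD ?ncevalM ?IH1 ?IH2.
Qed.

Lemma natmx_entry n c (i j : 'I_n.+1) : (c%:R : 'M[int]_n.+1) i j = c%:R *+ (i == j).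
Proof. by rewrite -[c%:R](rmorph_nat (@scalar_mx int n.+1)) mxE. Qed.

(** The matrices whose row i is a multiple of the i-th unit vector form a ring, and
    the factor is multiplicative and additive. *)
Lemma ring_eval_row n (v : nat -> 'M[int]_n.+1) (x : nat -> nat) i :
  (forall k j, v k i j = (x k)%:R *+ (i == j)) ->
  forall t j, ring_eval v t i j = (eval x t)%:R *+ (i == j).
Proof.
move=> vx; elim=> /= [k|c|t1 IH1 t2 IH2|t1 IH1 t2 IH2] j.
- exact: vx.
- exact: natmx_entry.
- by rewrite mxE IH1 IH2 natrD mulrnDl.
rewrite mxE (bigD1 i) //= IH1 eqxx IH2 big1 ?addr0 ?natrM ?mulrnAr // => l l_i.
by rewrite IH1 eq_sym (negPf l_i) mul0r.
Qed.

(** A strict bound for the variables, needed to realize a system over infinitely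
    many names with finitely many matrices. *)
Fixpoint expr_top (t : expr) : nat :=
  match t with
  | EVar i => i.+1
  | ECst _ => 0
  | EAdd t1 t2 | EMul t1 t2 => maxn (expr_top t1) (expr_top t2)
  end.

Lemma eq_eval_top v w t : (forall i, (i < expr_top t)%N -> v i = w i) -> eval v t = eval w t.
Proof.
elim: t => //= [i H|t1 IH1 t2 IH2 H|t1 IH1 t2 IH2 H]; first exact: H.
all: by congr (_ _ _); [apply: IH1|apply: IH2] => i lt_i; apply: H; rewrite leq_max lt_i ?orbT.
Qed.

Section System.
Variables (n : nat) (sys : seq (expr * expr)).

Definition sys_top := (\max_(p <- sys) maxn (expr_top p.1) (expr_top p.2))%N.

Definition unit_count := #|{: 'I_n.+1 * 'I_n.+1}|.

Definition nvars_of := (sys_top.+1 + unit_count)%N.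

Definition scalar_var (i : 'I_sys_top.+1) : 'I_nvars_of := lshift unit_count i.
Definition unit_var (i j : 'I_n.+1) : 'I_nvars_of := rshift sys_top.+1 (enum_rank (i, j)).

Lemma split_scalar_var i : split (scalar_var i) = inl i.
Proof. exact: (unsplitK (inl i)). Qed.

Lemma split_unit_var i j : split (unit_var i j) = inr (enum_rank (i, j)).
Proof. exact: (unsplitK (inr _)). Qed.

#[local] Opaque scalar_var unit_var.

(** Every parameter is the unknown 0, and the existential unknown j is the unknown
    j + 1. *)
Definition sys_var (i : nat) : 'I_sys_top.+1 := inord (if odd i then i./2.+1 else 0).

Definition ncvar (i : 'I_nvars_of) : ncpoly nvars_of := << fmu i >>.

Definition param_eq (a : nat) : ncpoly nvars_of :=
  ncvar (scalar_var ord0) - << a%:Z *g (@mone {fmonom 'I_nvars_of}) >>.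

Definition unit_sum_eq : ncpoly nvars_of := \sum_j ncvar (unit_var j j) - 1.

(** The sum on the left can be the identity only if the matrix V_jj is nonzero.  In
    the intended solution V_ij is the matrix unit at (i, j). *)
Definition unit_nonzero_eq (j : 'I_n.+1) : ncpoly nvars_of :=
  \sum_i ncvar (unit_var i j) * ncvar (unit_var j j) * ncvar (unit_var j i) - 1.

Definition diagonal_eq (i : 'I_sys_top.+1) : ncpoly nvars_of :=
  ncvar (scalar_var i) * ncvar (unit_var ord0 ord0)
  - ncvar (unit_var ord0 ord0) * ncvar (scalar_var i).

Definition expr_eq (p : expr * expr) : ncpoly nvars_of :=
  ring_eval (fun i => ncvar (scalar_var (sys_var i))) p.1
  - ring_eval (fun i => ncvar (scalar_var (sys_var i))) p.2.

Definition gadget_eqs : seq (ncpoly nvars_of) :=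
  map unit_nonzero_eq (enum 'I_n.+1)
  ++ map diagonal_eq (enum 'I_sys_top.+1) ++ map expr_eq sys.

Definition system_at (a : nat) : ncsystem :=
  @NCSystem nvars_of [:: param_eq a, unit_sum_eq & gadget_eqs].

Lemma nceval_ncvar (X : 'I_nvars_of -> 'M[int]_n.+1) i : nceval X (ncvar i) = X i.
Proof. exact: nceval_var. Qed.

Lemma nceval_param (X : 'I_nvars_of -> 'M[int]_n.+1) a :
  nceval X (param_eq a) = X (scalar_var ord0) - a%:R.
Proof.
rewrite ncevalB nceval_var nceval_mmap mmapU mmorph1 mulr1; congr (_ - _).
by rewrite -(rmorph_nat (@scalar_mx int n.+1)) natz.
Qed.

(** The solution is read at the diagonal position t of the only nonzero entry of
    V_00. *)
Lemma satisfies_of_solution a :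
  solvable_in_nat_matrices n.+1 (system_at a) -> exists e, satisfies (interleave (fun=> a) e) sys.
Proof.
move=> [X sol]; rewrite [nvars _]/= in X sol.
pose W (i : 'I_nvars_of) := map_mx Posz (X i).
have {}sol P : P \in [:: param_eq a, unit_sum_eq & gadget_eqs] -> nceval W P = 0 by apply: sol.
have sol_param : nceval W (param_eq a) = 0 by apply/sol/mem_head.
have sol_sum : nceval W unit_sum_eq = 0 by apply: sol; rewrite in_cons mem_head orbT.
have sol_rest P : P \in gadget_eqs -> nceval W P = 0.
  by move=> P_in; apply: sol; rewrite in_cons in_cons; apply/or3P; constructor 3.
have sol_unit j : nceval W (unit_nonzero_eq j) = 0.
  by apply: sol_rest; rewrite !mem_cat; apply/or3P; constructor 1; apply: map_f; rewrite mem_enum.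
have sol_diag i : nceval W (diagonal_eq i) = 0.
  by apply: sol_rest; rewrite !mem_cat; apply/or3P; constructor 2; apply: map_f; rewrite mem_enum.
have sol_sys p : p \in sys -> nceval W (expr_eq p) = 0.
  by move=> p_in; apply: sol_rest; rewrite !mem_cat; apply/or3P; constructor 3; apply: map_f.
have sumV s s' : (\sum_j X (unit_var j j) s s' = (s == s'))%N.
  have := sol_sum.
  rewrite ncevalB nceval_sum => /eqP; rewrite subr_eq0 => /eqP/matrixP/(_ s s').
  rewrite nceval1 (natmx_entry 1) summxE.
  rewrite (eq_bigr (fun j => Posz (X (unit_var j j) s s'))) => [|j _].
    by rewrite -(big_morph Posz PoszD erefl); case: eqVneq => _ [].
  by rewrite nceval_ncvar mxE.
have nzV j : exists s s', X (unit_var j j) s s' != 0%N.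
  case: (pickP (fun p => X (unit_var j j) p.1 p.2 != 0%N)) => [p nz|V0]; first by exists p.1, p.2.
  have WV0 : W (unit_var j j) = 0.
    apply/matrixP => s s'; rewrite !mxE; have /= := V0 (s, s').
    by move/eqP->.
  have := sol_unit j.
  rewrite ncevalB nceval_sum big1 => [|i _]; last by rewrite !ncevalM !nceval_ncvar WV0 mulr0 mul0r.
  by rewrite nceval1 sub0r => /eqP; rewrite oppr_eq0 oner_eq0.
have [t Vt] := unit_decomposition sumV nzV.
have rowX k s : W (scalar_var k) t s = (X (scalar_var k) t t)%:R *+ (t == s).
  have := sol_diag k.
  rewrite nceval_commutator !nceval_ncvar => /eqP; rewrite subr_eq0 => /eqP/matrixP/(_ t s).
  rewrite !mxE (bigD1 t) //= big1 ?addr0 => [|l l_t]; last first.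
    by rewrite ![W _ _ _]mxE Vt (negPf l_t) /= mulr0.
  rewrite [RHS](bigD1 t) //= big1 ?addr0 => [|l l_t]; last first.
    by rewrite ![W _ _ _]mxE Vt (negPf l_t) andbF mul0r.
  rewrite ![W (unit_var _ _) _ _]mxE !Vt eqxx /= mul1r.
  rewrite ![W (scalar_var k) _ _]mxE => <-.
  by rewrite natz eq_sym; case: eqP; rewrite ?mulr1 ?mulr0.
pose x i := X (scalar_var (sys_var i)) t t.
have Ex : x =1 interleave (fun=> a) (fun j => X (scalar_var (inord j.+1)) t t).
  move=> i; rewrite /x /interleave /sys_var; case: (odd i) => //.
  have /eqP := sol_param; rewrite nceval_param subr_eq0 => /eqP/matrixP/(_ t t).
  rewrite natmx_entry eqxx mxE natz => -[<-]; congr (X (scalar_var _) t t).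
  by apply/val_inj; rewrite /= inordK.
exists (fun j => X (scalar_var (inord j.+1)) t t); rewrite -(eq_satisfies _ Ex).
apply/allP => p p_in; have := sol_sys _ p_in.
rewrite ncevalB !nceval_expr => /eqP; rewrite subr_eq0 => /eqP/matrixP/(_ t t).
have rowX' k s := rowX (sys_var k) s.
by rewrite !(ring_eval_row rowX') eqxx !natz => -[/eqP].
Qed.

Lemma solution_of_satisfies a e : satisfies (interleave (fun=> a) e) sys ->
  solvable_in_nat_matrices n.+1 (system_at a).
Proof.
move=> He; pose x (i : 'I_sys_top.+1) := if i == ord0 then a else e i.-1.
pose X (i : 'I_nvars_of) : 'M[nat]_n.+1 :=
  match split i with
  | inl k => \matrix_(s, s') (if s == s' then x k else 0%N)
  | inr l => \matrix_(s, s') ((s == (enum_val l).1) && (s' == (enum_val l).2) : nat)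
  end.
have [W [EW Wscalar Wunit]] : exists W : 'I_nvars_of -> 'M[int]_n.+1,
    [/\ W = (fun i => map_mx Posz (X i)),
        forall k, W (scalar_var k) = (x k)%:R &
        forall i j, W (unit_var i j) = delta_mx i j].
  exists (fun i => map_mx Posz (X i)); split=> // [k|i j]; apply/matrixP => s s'.
    by rewrite natmx_entry !mxE /X split_scalar_var mxE natz; case: eqP.
  by rewrite !mxE /X split_unit_var mxE enum_rankK /= natz.
exists X; rewrite -{}EW.
have sol_sum : nceval W unit_sum_eq = 0.
  rewrite ncevalB nceval_sum nceval1; apply/eqP; rewrite subr_eq0; apply/eqP.
  by rewrite -[1]/(1%:M) mx1_sum_delta; apply: eq_bigr => j _; rewrite nceval_ncvar Wunit.
have sol_unit j : nceval W (unit_nonzero_eq j) = 0.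
  rewrite ncevalB nceval_sum nceval1; apply/eqP; rewrite subr_eq0; apply/eqP.
  rewrite -[1]/(1%:M) mx1_sum_delta; apply: eq_bigr => i _.
  by rewrite !ncevalM !nceval_ncvar !Wunit -!mulmxE !mul_delta_mx.
have sol_diag i : nceval W (diagonal_eq i) = 0.
  rewrite nceval_commutator !nceval_ncvar (Wscalar i); apply/eqP; rewrite subr_eq0.
  exact/eqP/esym/commr_nat.
have Ex i : (i < sys_top)%N -> interleave (fun=> a) e i = x (sys_var i).
  move=> i_lt; rewrite /interleave /sys_var /x -val_eqE /=; case: (odd i); last by rewrite inordK.
  by rewrite inordK //= ltnS; lia.
have row_x s i s' : W (scalar_var (sys_var i)) s s' = (x (sys_var i))%:R *+ (s == s').
  by rewrite Wscalar natmx_entry.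
have sol_sys p : p \in sys -> nceval W (expr_eq p) = 0.
  move=> p_in; have top_p : (maxn (expr_top p.1) (expr_top p.2) <= sys_top)%N.
    exact: (leq_bigmax_seq _ p_in).
  rewrite ncevalB !nceval_expr; apply/eqP; rewrite subr_eq0; apply/eqP/matrixP => s s'.
  rewrite !(ring_eval_row (row_x s)); congr (_%:R *+ _).
  have := allP He p p_in.
  rewrite (@eq_eval_top _ (fun i => x (sys_var i))) => [|i lt_i]; last first.
    by apply: Ex; apply: leq_trans top_p; rewrite leq_max lt_i.
  rewrite (@eq_eval_top _ (fun i => x (sys_var i)) p.2) => [/eqP//|i lt_i].
  by apply: Ex; apply: leq_trans top_p; rewrite leq_max lt_i orbT.
move=> P; change (P \in [:: param_eq a, unit_sum_eq & gadget_eqs] -> nceval W P = 0).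
rewrite in_cons => /predU1P[->|]; first by rewrite nceval_param Wscalar /x eqxx subrr.
rewrite in_cons => /predU1P[->|]; first exact: sol_sum.
rewrite !mem_cat => /or3P[] /mapP[p p_in ->]; [exact: sol_unit|exact: sol_diag|exact: sol_sys].
Qed.

End System.

End Matrices.

(** * Codes of systems and self-reference *)

Section Code.
Variables (n : nat) (sys : seq (expr * expr)).

Definition code_prefix : seq letter := nseq (nvars_of n sys) One ++ [:: Equation; Term; Minus].

Definition code_suffix : seq letter :=
  [:: Term; One; Var] ++ flatten [seq code_poly P | P <- unit_sum_eq n sys :: gadget_eqs n sys].

Lemma word_le_trans k : transitive (@word_le k).
Proof. by move=> u v w; apply: (@le_trans _ (seqlexi 'I_k)). Qed.

Lemma word_le_anti k : antisymmetric (@word_le k).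
Proof. by move=> u v H; apply: val_inj; apply: (@le_anti _ (seqlexi 'I_k)). Qed.

Lemma word_le_total k : total (@word_le k).
Proof. by move=> u v; apply: (@le_total _ (seqlexi 'I_k)). Qed.

(** The empty word comes first in lexicographic order, and the constant is negative,
    so the code is a fixed prefix, a in unary, and a fixed suffix. *)
Lemma code_param_eq a : 0 < a ->
  code_poly (param_eq n sys a) = [:: Equation; Term; Minus] ++ nseq a One ++ [:: Term; One; Var].
Proof.
case: a => // a _; rewrite /code_poly; set P := param_eq n sys a.+1.
pose x : {fmonom 'I_(nvars_of n sys)} := fmu (scalar_var n (ord0 : 'I_(sys_top sys).+1)).
have coeffP m : (P@_m = (x == m)%:R - (a.+1)%:Z *+ (@mone _ == m))%R.
  by rewrite /P /param_eq mcoeffB !mcoeffU.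
have x_1 : (x == @mone _) = false by rewrite fmP fmU fm1.
have -> : sort (@word_le _) (msupp P) = [:: @mone _; x].
  apply: (sorted_eq (@word_le_trans _) (@word_le_anti _)).
  - exact/sort_sorted/word_le_total.
  - by rewrite /= andbT /word_le fm1 lexi0s.
  rewrite perm_sort; apply: uniq_perm; rewrite ?fset_uniq //= ?inE ?andbT 1?eq_sym ?x_1 //.
  move=> m; rewrite !inE -mcoeff_neq0 coeffP [m == x]eq_sym [m == _]eq_sym.
  have [<-|_] := eqVneq (@mone _) m; first by rewrite x_1.
  by case: (x == m).
have c1 : (P@_(@mone _) = Negz a)%R by rewrite coeffP x_1 eqxx sub0r.
have cx : (P@_x = 1)%R by rewrite coeffP eqxx [mone == x]eq_sym x_1 subr0.
by rewrite /= c1 cx /code_word fm1 fmU /= -catA.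
Qed.

Lemma code_system_at a : 0 < a ->
  code_system (system_at n sys a) = code_prefix ++ nseq a One ++ code_suffix.
Proof.
move=> a_gt0; rewrite /code_prefix /code_suffix -!catA.
rewrite (catA _ [:: Term; One; Var]) (catA [:: Equation; Term; Minus]).
by rewrite -code_param_eq.
Qed.

End Code.

(** At least (x + y)^2 and below (x + y + 1)^2, which determines x + y, then x. *)
Definition pair_code (x y : nat) := (x + y) * (x + y) + x.

Lemma pair_code_inj x y x' y' : pair_code x y = pair_code x' y' -> x = x' /\ y = y'.
Proof.
rewrite /pair_code; move Es: (x + y) => s; move Es': (x' + y') => s' E.
have : s = s' by nia.
by lia.
Qed.

Section Rejection.
Variable M : machine letter.

Definition tape_digit : nat := digit (Some (inl One) : symbol M).

(** The number a codes the number p of the word u, the power P of the base that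
    shifts past u, and the number s of the word w; E shifts past 1^a and R is the
    number of 1^a up to the factor [tape_digit].  The left half of the tape is empty,
    so the first coordinate is the number of the initial state. *)
Definition rejects_code (a : nat) : Prop :=
  exists p P s E R,
    [/\ a = (pair_code (pair_code p P) s).+1, E = tape_base M ^ a, E + R = 1 + tape_base M * R &
        vanishes (@machine_rule _ M) (state_num (start M))
          (p + P * (tape_digit * R + E * s))].

Lemma tape_base_gt1 : 1 < tape_base M.
Proof.
rewrite /tape_base ltnS; apply/card_gt0P.
by exists (inl One).
Qed.

Lemma dioph_rejects_code : dioph (fun v => rejects_code (v 0)).
Proof.
apply: (@dioph_ext (fun v => exists p P s E R,
    ((v 0 = (pair_code (pair_code p P) s).+1 /\ E = tape_base M ^ v 0) /\
     E + R = 1 + tape_base M * R) /\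
        vanishes (@machine_rule _ M) (state_num (start M))
          (p + P * (tape_digit * R + E * s)))).
  by move=> v; split=> -[p [P [s [E [R]]]]]; [case=> -[[? ?] ?] ?|case=> ? ? ? ?];
    exists p, P, s, E, R.
rewrite /pair_code; do 5! [apply: dioph_ex]; apply: dioph_and.
  apply: dioph_and; last by prove_dioph.
  apply: dioph_and; first by prove_dioph.
  by apply: dioph_expn => *; [exact: tape_base_gt1|prove_polyn|prove_polyn|prove_polyn].
by apply: dioph_vanishes; prove_polyn.
Qed.

Definition tape_num (w : seq letter) : nat :=
  half_tape_num [seq (Some (inl l) : symbol M) | l <- w].

Lemma tape_num_nseq a : tape_num (nseq a One) = tape_digit * repunit (tape_base M) a.
Proof.
elim: a => [|a IHa]; first by rewrite muln0.
by rewrite /tape_num /= -/(tape_num _) IHa mulnDr muln1 mulnCA.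
Qed.

Lemma answers_false w : answers M w false <->
  vanishes (@machine_rule _ M) (state_num (start M)) (tape_num w).
Proof.
by rewrite /answers -vanishes_config /= muln0 addn0.
Qed.

Lemma answers_inj w b b' : answers M w b -> answers M w b' -> b = b'.
Proof.
have stable t t' c b1 : verdict (iter t (@step _ M) c).1 = Some b1 ->
    verdict (iter (t' + t) (@step _ M) c).1 = Some b1.
  by elim: t' => //= t' IH /IH; case: (iter (t' + t) _ c) => [q [l r]] /= vq; rewrite vq.
case=> t H [t' H']; have E := stable t t' _ _ H; have E' := stable t' t _ _ H'.
by move: E; rewrite addnC E' => -[].
Qed.

(** The pairing is injective, so p, P and s can only be the intended numbers. *)
Lemma rejects_codeP u w p P s a :
  p = tape_num u -> P = tape_base M ^ size u -> s = tape_num w ->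
  a = (pair_code (pair_code p P) s).+1 ->
  rejects_code a <-> answers M (u ++ nseq a One ++ w) false.
Proof.
move=> Ep EP Es Ea.
have tapeE : tape_num (u ++ nseq a One ++ w)
    = p + P * (tape_digit * repunit (tape_base M) a + tape_base M ^ a * s).
  by rewrite Ep EP Es /tape_num !map_cat !half_tape_num_cat !size_map size_nseq -tape_num_nseq.
rewrite answers_false tapeE; split.
  move=> [p' [P' [s' [E [R [Ea' -> ER H]]]]]]; move: Ea'; rewrite {1}Ea => -[].
  case/pair_code_inj => /pair_code_inj[-> ->] ->.
  by have -> : repunit (tape_base M) a = R by apply/esym/repunitP; [exact: tape_base_gt1|].
move=> H; exists p, P, s, (tape_base M ^ a), (repunit (tape_base M) a); split=> //.
by apply/repunitP; first exact: tape_base_gt1.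
Qed.

End Rejection.

(** The number a is chosen so that the system at a is solvable if and only if M
    rejects the code of this very system. *)
Theorem theorem1p2 (n : nat) (n_ge1 : (1 <= n)%N) :
  undecidable code_system (solvable_in_nat_matrices n).
Proof.
case: n n_ge1 => // n _ [M decM].
have [sys rejP] := dioph_rejects_code M.
pose u := code_prefix n sys; pose w := code_suffix n sys.
pose a := (pair_code (pair_code (tape_num M u) (tape_base M ^ size u)) (tape_num M w)).+1.
have solP : solvable_in_nat_matrices n.+1 (system_at n sys a) <->
    answers M (code_system (system_at n sys a)) false.
  rewrite code_system_at // -(rejects_codeP erefl erefl erefl erefl) -/a.
  rewrite (rejP (fun=> a)); split; first exact: satisfies_of_solution.
  by case=> e; apply: solution_of_satisfies.
have [[] [ans bP]] := decM (system_at n sys a).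
  by have /solP/(answers_inj ans) : solvable_in_nat_matrices n.+1 (system_at n sys a) by apply/bP.
by have /bP : solvable_in_nat_matrices n.+1 (system_at n sys a) by apply/solP.
Qed.
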